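(* Let $j,r\ge0$ and $k\ge1$ be integers with $j+r\le k$. Then \[ \sum_{s_1\ge\cdots\ge s_k\ge0}\frac{q^{\frac{s_1^2}{2}+s_2^2+\cdots+s_k^2+\frac{s_1}{2}-\sum_{i=1}^{j}s_i+\sum_{i=k-r+1}^{k}s_i}\,(-1;q)_{s_1}}{(q)_{s_1-s_2}\cdots(q)_{s_{k-1}-s_k}(q)_{s_k}} =\frac{(-q;q)_\infty}{(q;q)_\infty}\sum_{s=0}^{2j}\sum_{t=0}^{2r}(-1)^t(q^{2k+2},q^{k+1-r-j+s+t},q^{k+1+r+j-s-t};q^{2k+2})_\infty. \]
   Context: $q$ is a complex number with $|q|<1$. $(x;q)_n=\prod_{m=0}^{n-1}(1-xq^m)$, $(x)_n=(x;q)_n$, $(x;q)_\infty=\prod_{m\ge0}(1-xq^m)$, $(x_1,\dots,x_m;q)_\infty=\prod_i(x_i;q)_\infty$. Empty sums are $0$. *)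

(* Defs.v *)
From HB Require Import structures.
From mathcomp Require Import all_boot all_order all_algebra.
From mathcomp Require Import complex.
From mathcomp Require Import all_classical all_reals all_analysis.
From mathcomp Require showcase.summability.
Set Implicit Arguments.
Unset Strict Implicit.
Unset Printing Implicit Defensive.
Import Order.TTheory GRing.Theory Num.Theory.
Import numFieldNormedType.Exports.
Local Open Scope classical_set_scope.
Local Open Scope ring_scope.
Local Open Scope complex_scope.

(* The complex numbers are R[i] for R : realType. Mathcomp-analysis puts the
   topology of the modulus on the copy R[i]^o of R[i], hence the casts. *)

Definition qpoch (R : realType) (x q : R[i]) (n : nat) : R[i] :=
  \prod_(0 <= m < n) (1 - x * q ^+ m).

(* `lim` is total; the partial products do converge as soon as `|q| < 1. *)
Definition qpoch_inf (R : realType) (x q : R[i]) : R[i] :=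
  lim ((qpoch x q n : R[i]^o) @[n --> \oo]).

Definition qpochs_inf (R : realType) (xs : seq R[i]) (q : R[i]) : R[i] :=
  \prod_(x <- xs) qpoch_inf x q.

(* Unordered convergence: the sums over finite subsets of I converge to l
   along the directed set of finite subsets. For complex terms this amounts to
   absolute convergence with sum l. *)
Definition has_sum (R : realType) (I : choiceType) (f : I -> R[i]) (l : R[i])
    : Prop :=
  summability.partial_sum (f : I -> R[i]^o) A @[A --> summability.totally]
    --> (l : R[i]^o).

(* s_1 >= ... >= s_k >= 0 *)
Definition noninc (k : nat) := {s : k.-tuple nat | sorted geq s}.

(* s_i with the indexing from 1, meaningful for 1 <= i <= k *)
Definition part (k : nat) (s : noninc k) (i : nat) : nat :=
  nth 0%N (val (val s)) i.-1.

(* s_1^2/2 + s_1/2 is the integer (s_1^2 + s_1)/2, so that the halving of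
   natural numbers is exact here. *)
Definition multisum_exponent (k j r : nat) (s : noninc k) : int :=
  ((part s 1 ^ 2 + part s 1)./2)%N%:Z
  + \sum_(2 <= i < k.+1) (part s i)%:Z ^+ 2
  - \sum_(1 <= i < j.+1) (part s i)%:Z
  + \sum_((k - r).+1 <= i < k.+1) (part s i)%:Z.

Definition multisum_term (R : realType) (q : R[i]) (k j r : nat)
    (s : noninc k) : R[i] :=
  q ^ multisum_exponent j r s * qpoch (-1) q (part s 1)
  / (\prod_(1 <= i < k) qpoch q q (part s i - part s i.+1)
     * qpoch q q (part s k)).

(* Main.v *)
(* Write K(n, m) = 1 / ((q)_{n-m} (q)_{n+m}) and x = q^m. The q-Vandermonde sum shows that
   one summation against q^{s^2} / (q)_{n-s} maps K(., m) to q^{m^2} K(n, m), while one against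
   q^{s^2-s} / (q)_{n-s} maps it to q^{m^2} (x + 1/x - q^n) K(n, m); iterating the latter
   yields Chebyshev polynomials in x, that is, geometric sums. Starting from the expansion
   of [n = 0] given by the unit Bailey pair, the s_k, ..., s_2 sums of the multisum are
   evaluated in turn: first the r sums with + s_i (in the basis 1 / ((q)_{n-m} (q)_{n+m+1}),
   where they are diagonal), then those without linear term, then those with - s_i.
   The sum over s_1, truncated by a further factor 1 / (q)_{n-s_1}, is of the same kind, and n
   tends to infinity by dominated convergence. What remains is a sum over m of theta type,
   a combination of the series of Jacobi's triple product identity; the latter is the limit
   of a finite identity obtained from the q-binomial theorem. *)
Require Import Defs.
From HB Require Import structures.
From mathcomp Require Import all_boot all_order all_algebra.
From mathcomp Require Import complex.
From mathcomp Require Import all_classical all_reals all_analysis.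
From mathcomp Require Import finmap ring lra zify.
Set Implicit Arguments.
Unset Strict Implicit.
Unset Printing Implicit Defensive.
Import Order.TTheory GRing.Theory Num.Theory.
Import numFieldNormedType.Exports.
Local Open Scope ring_scope.
Local Open Scope complex_scope.

(** Before the limit everything is an identity of rational functions, valid in any field where no
    q^(n+1) is 1 and no q^n is -1; the truncation by 1 / (q)_(n-s_1) makes the sum over s_1 one more
    step of the same kind as the others. The weights q^(s^2) and q^(s^2+s) are diagonal in a
    suitable kernel and only multiply the coefficients. The obstacle is q^(s^2-s), whose image
    contains q^n K(n, m). The span of K and q^n K is stable, which makes the iteration possible, but
    the step for s_1 then leaves a remainder with the factor q^n / (1 + q^n); it is carried along as
    [defect] and disappears only in the limit. The value q = 0 is allowed, so negative powers are
    avoided: bilateral sums are folded onto m >= 0 with weight 1/2 at m = 0, the Chebyshev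
    polynomials are rescaled, and the q-binomial theorem is homogeneous. The cases j > 0, j = 0 with
    r < k, and r = k differ in what is added to the exponent of s_1: - s_1, nothing, or + s_1. *)

(** * q-Vandermonde summation *)

(* [qpoch] over an arbitrary field; for [F = R[i]] the two are convertible. *)
Definition qp (F : fieldType) (x q : F) (n : nat) : F :=
  \prod_(0 <= m < n) (1 - x * q ^+ m).

Lemma qp0 (F : fieldType) (x q : F) : qp x q 0 = 1.
Proof. by rewrite /qp big_nil. Qed.

Lemma qpS (F : fieldType) (x q : F) n : qp x q n.+1 = qp x q n * (1 - x * q ^+ n).
Proof. by rewrite /qp big_nat_recr. Qed.

Lemma qpSl (F : fieldType) (x q : F) n : qp x q n.+1 = (1 - x) * qp (x * q) q n.
Proof.
rewrite /qp big_nat_recl //= expr0 mulr1; congr (_ * _).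
by apply: eq_bigr => i _; rewrite exprS mulrA.
Qed.

Lemma qpD (F : fieldType) (x q : F) m n :
  qp x q (m + n) = qp x q m * qp (x * q ^+ m) q n.
Proof.
elim: n => [|n IH]; first by rewrite addn0 qp0 mulr1.
by rewrite addnS !qpS IH -mulrA -(mulrA x) -exprD.
Qed.

(** The Gaussian binomial coefficient, given by a Pascal rule rather than as a quotient. *)
Fixpoint gbin (F : fieldType) (q : F) (n l : nat) : F :=
  match n, l with
  | _, 0%N => 1
  | 0%N, _.+1 => 0
  | n'.+1, l'.+1 => gbin q n' l' + q ^+ l'.+1 * gbin q n' l'.+1
  end.

Lemma gbin0 (F : fieldType) (q : F) n : gbin q n 0 = 1.
Proof. by case: n. Qed.

Lemma gbin_small (F : fieldType) (q : F) n l : (n < l)%N -> gbin q n l = 0.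
Proof.
elim: n l => [|n IH] [|l] //= lt_nl.
by rewrite !IH ?mulr0 ?addr0 //; lia.
Qed.

(** Both terms of the Pascal rule give a multiple of (q)_n, and 1 - q^(l+1) + q^(l+1) (1 - q^(n-l))
    = 1 - q^(n+1). *)
Lemma gbin_qp (F : fieldType) (q : F) n l : (l <= n)%N ->
  gbin q n l * qp q q l * qp q q (n - l) = qp q q n.
Proof.
elim: n l => [|n IH] [|l] //= le_ln.
- by rewrite !qp0 !mulr1.
- by rewrite qp0 subn0 !mul1r.
rewrite subSS.
have E1 := IH l le_ln.
have [lt_ln|] := ltnP l n; last first.
  move=> le_nl; have -> : l = n by lia.
  rewrite (@gbin_small _ q n n.+1) // mulr0 addr0 subnn qp0 mulr1 !qpS -exprS.
  have := IH n (leqnn n); rewrite subnn qp0 mulr1 => E.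
  by rewrite mulrA E.
have E2 := IH l.+1 lt_ln.
have en : (n - l)%N = (n - l.+1).+1 by lia.
have qe : q ^+ l.+1 * q ^+ (n - l) = q ^+ n.+1 by rewrite -exprD; congr (_ ^+ _); lia.
rewrite mulrDl mulrDl (qpS q q n) -exprS -qe.
have E1' : gbin q n l * qp q q l.+1 * qp q q (n - l) = qp q q n * (1 - q ^+ l.+1).
  by rewrite (qpS _ _ l) -E1 -exprS; ring.
have E2' : gbin q n l.+1 * qp q q l.+1 * qp q q (n - l) = qp q q n * (1 - q ^+ (n - l)).
  by rewrite {1}en (qpS _ _ (n - l.+1)) -exprS -en -E2; ring.
by rewrite E1' -2!mulrA (mulrA (gbin _ _ _)) E2'; ring.
Qed.

(** Homogenised q-Chu-Vandermonde summand: for d != 0 the product is d^l (e/d)_l; the limiting case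
    d = 0 yields the weights q^(l^2+cl). *)
Definition vand_term (F : fieldType) (q d e : F) (n l : nat) : F :=
  (-1) ^+ l * q ^+ 'C(l, 2) * (\prod_(i < l) (d - e * q ^+ i))
  * qp (e * q ^+ l) q (n - l).

(* Writing [V(n; d, e)] for the left-hand side, the Pascal rule yields
   [V(n+1; d, e) = (1 - d) V(n; d q, e q)]. *)
Lemma q_vandermonde (F : fieldType) (q d e : F) n :
  \sum_(l < n.+1) gbin q n l * vand_term q d e n l = qp d q n.
Proof.
elim: n d e => [|n IH] d e.
  by rewrite big_ord_recl big_ord0 /vand_term /= big_ord0 !qp0 expr0 !mulr1 addr0.
rewrite qpSl -(IH (d * q) (e * q)) big_ord_recl /=.
under eq_bigr => l _ do rewrite /bump /= add1n mulrDl.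
rewrite big_split /= addrA addrAC mulr_sumr.
have -> : 1 * vand_term q d e n.+1 0 +
   \sum_(l < n.+1) q ^+ l.+1 * gbin q n l.+1 * vand_term q d e n.+1 l.+1
   = \sum_(l < n.+2) q ^+ l * gbin q n l * vand_term q d e n.+1 l.
  by rewrite [RHS]big_ord_recl /= gbin0 expr0 mulr1.
rewrite big_ord_recr /= (@gbin_small _ q n n.+1) // mulr0 mul0r addr0 -big_split /=.
apply: eq_bigr => l _.
have le_ln : (l <= n)%N by rewrite -ltnS.
(* Termwise, the two Pascal contributions combine through q^l (1 - e q^l) - q^l (d - e q^l) = q^l (1
   - d). *)
rewrite /vand_term subSS subSn // qpSl binS bin1 big_ord_recr /= !exprS exprD.
have -> : \prod_(i < l) (d * q - e * q * q ^+ i) = q ^+ l * \prod_(i < l) (d - e * q ^+ i).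
  rewrite -[X in q ^+ X]card_ord -prodr_const -big_split /=.
  by apply: eq_bigr => i _; ring.
have -> : e * (q * q ^+ l) = e * q ^+ l * q by ring.
have -> : e * q * q ^+ l = e * q ^+ l * q by ring.
ring.
Qed.

(** The clause q^0 != -1 says that 2 != 0, so that the weight 1/2 makes sense. *)
Definition qregular (F : fieldType) (q : F) :=
  (forall n, q ^+ n.+1 != 1) /\ (forall n, q ^+ n != -1).

Lemma qp_neq0 (F : fieldType) (q : F) n : qregular q -> qp q q n != 0.
Proof.
move=> [q1 _]; rewrite /qp prodf_seq_neq0; apply/allP => i _ /=.
by rewrite -exprS subr_eq0 eq_sym q1.
Qed.

Lemma qregular_neq0 (F : fieldType) (q : F) n : qregular q -> 1 + q ^+ n != 0.
Proof. by move=> [_ /(_ n)]; rewrite addrC addr_eq0. Qed.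

(** With e = q^(c+1) the factor (e q^l)_(n-l) is (q)_(c+n) / (q)_(c+l), so that division by (q)_n
    (q)_(c+n) produces the denominators of a Bailey kernel. *)
Lemma q_vandermonde_div (F : fieldType) (q d : F) c n : qregular q ->
  \sum_(l < n.+1) (-1) ^+ l * q ^+ 'C(l, 2) *
     (\prod_(i < l) (d - q ^+ c.+1 * q ^+ i)) /
     (qp q q (n - l) * qp q q l * qp q q (c + l))
  = qp d q n / (qp q q n * qp q q (c + n)).
Proof.
move=> hq; rewrite -(q_vandermonde q d (q ^+ c.+1)) mulr_suml.
apply: eq_bigr => l _.
have le_ln : (l <= n)%N by rewrite -ltnS.
have := gbin_qp q le_ln.
have := qpD q q (c + l) (n - l).
have -> : (c + l + (n - l) = c + n)%N by lia.
rewrite -exprS -addSn exprD => E1 E2.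
have h1 := qp_neq0 n hq; have h2 := qp_neq0 l hq; have h3 := qp_neq0 (n - l) hq.
have h4 := qp_neq0 (c + l) hq; have h5 := qp_neq0 (c + n) hq.
rewrite /vand_term.
move: h1 h5; rewrite E1 -E2 => h1 h5.
have h6 : qp (q ^+ c.+1 * q ^+ l) q (n - l) != 0.
  by apply: contraNneq h5 => ->; rewrite mulr0.
have h7 : gbin q n l != 0 by apply: contraNneq h1 => ->; rewrite !mul0r.
by field; rewrite h2 h3 h4 h6 h7.
Qed.

(** The case d = 0: the product becomes (-1)^l q^((c+1) l + 'C(l, 2)), and l^2 + c l = 2 'C(l, 2) +
    (c + 1) l. *)
Lemma q_vandermonde_sq (F : fieldType) (q : F) c n : qregular q ->
  \sum_(l < n.+1) q ^+ (l ^ 2 + c * l) /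
     (qp q q (n - l) * qp q q l * qp q q (c + l))
  = (qp q q n * qp q q (c + n))^-1.
Proof.
move=> hq; have := q_vandermonde_div 0 c n hq.
have -> : qp 0 q n = 1.
  by rewrite /qp big1 // => i _; rewrite mul0r subr0.
rewrite mul1r => <-; apply: eq_bigr => l _; congr (_ / _).
have -> : \prod_(i < l) (0 - q ^+ c.+1 * q ^+ i) = (-1) ^+ l * q ^+ (c.+1 * l + 'C(l, 2)).
  elim: (l : nat) => [|m IH]; first by rewrite big_ord0 expr0 muln0 mul1r.
  rewrite big_ord_recr /= IH binS bin1 mulnS (exprS (-1)) !exprD; ring.
have -> : (l ^ 2 + c * l = 'C(l, 2) + (c.+1 * l + 'C(l, 2)))%N.
  have := bin2_sum l; have := mul_bin_diag l 1; rewrite bin1; nia.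
by rewrite [in LHS]exprD mulrACA -expr2 sqrr_sign mul1r.
Qed.

(** The case d = - q^u: each factor d - q^(c+1+i) is - q^u (1 + q^(v+i)). This accounts for the
    factor (-1)_(s_1) of the multisum. *)
Lemma q_vandermonde_pair (F : fieldType) (q : F) c u v n : qregular q ->
  (u + v = c.+1)%N ->
  \sum_(l < n.+1) q ^+ ('C(l, 2) + u * l) * qp (- q ^+ v) q l /
     (qp q q (n - l) * qp q q l * qp q q (c + l))
  = qp (- q ^+ u) q n / (qp q q n * qp q q (c + n)).
Proof.
move=> hq huv; rewrite -(q_vandermonde_div (- q ^+ u) c n hq).
apply: eq_bigr => l _; congr (_ / _).
have -> : \prod_(i < l) (- q ^+ u - q ^+ c.+1 * q ^+ i) =
    (-1) ^+ l * q ^+ (u * l) * qp (- q ^+ v) q l.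
  elim: (l : nat) => [|m IH]; first by rewrite big_ord0 expr0 muln0 qp0 !mul1r.
  rewrite big_ord_recr /= IH qpS -huv mulnS (exprS (-1)) !exprD; ring.
have sq := sqrr_sign F l.
transitivity (((-1) ^+ l) ^+ 2 * (q ^+ 'C(l, 2) * q ^+ (u * l) * qp (- q ^+ v) q l)).
  by rewrite sq exprD mul1r.
ring.
Qed.

(** * Bailey steps *)

(* The kernel of Bailey pairs relative to [a = q^c], without the factor [(q)_c]. *)
Definition kern (F : fieldType) (q : F) (c n m : nat) : F :=
  if (m <= n)%N then (qp q q (n - m) * qp q q (n + m + c))^-1 else 0.

Lemma kern_small (F : fieldType) (q : F) c n m : (n < m)%N -> kern q c n m = 0.
Proof. by move=> lt_nm; rewrite /kern leqNgt lt_nm. Qed.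

Definition bstep (F : fieldType) (q : F) (W b : nat -> F) (n : nat) : F :=
  \sum_(s < n.+1) W s / qp q q (n - s) * b s.

(** Only s >= m contributes, and s = m + l leaves a Vandermonde sum with parameter 2 m + c. *)
Lemma bstep_kern (F : fieldType) (q : F) (W : nat -> F) c n m : (m <= n)%N ->
  bstep q W (kern q c ^~ m) n =
  \sum_(l < (n - m).+1) W (m + l)%N /
     (qp q q (n - m - l) * qp q q l * qp q q (2 * m + c + l)).
Proof.
move=> le_mn; rewrite /bstep -(big_mkord xpredT (fun s => W s / qp q q (n - s) * kern q c s m)).
rewrite (@big_cat_nat _ _ _ m) /=; [|by []|by lia].
rewrite big_nat big1 ?add0r; last first.
  by move=> i /andP[_ lt_im]; rewrite kern_small ?mulr0.
rewrite -{1}[m]add0n big_addn big_mkord -subSn //.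
apply: eq_bigr => l _; rewrite /kern leq_addl (addnC l m) addKn.
rewrite -mulrA -invfM mulrA.
have -> : (n - (m + l) = n - m - l)%N by lia.
by have -> : (m + l + m + c = 2 * m + c + l)%N by lia.
Qed.

Lemma bstep_kern_small (F : fieldType) (q : F) (W : nat -> F) c n m : (n < m)%N ->
  bstep q W (kern q c ^~ m) n = 0.
Proof.
move=> lt_nm; rewrite /bstep big1 // => s _.
by rewrite kern_small ?mulr0 //; have := ltn_ord s; lia.
Qed.

(** A step acts on the kernel alone and keeps the coefficients: triangularity of K lets all inner
    sums run over the same range m <= n, after which the sums are exchanged. *)
Lemma bstep_expand (F : fieldType) (q : F) (W b a : nat -> F) (K K' : nat -> nat -> F) :
  (forall n m, (n < m)%N -> K n m = 0) ->
  (forall n m, bstep q W (K ^~ m) n = K' n m) ->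
  (forall n, b n = \sum_(m < n.+1) a m * K n m) ->
  forall n, bstep q W b n = \sum_(m < n.+1) a m * K' n m.
Proof.
move=> K0 KK' bE n.
under [RHS]eq_bigr => m _ do rewrite -KK' /bstep mulr_sumr.
rewrite exchange_big /=; apply: eq_bigr => s _.
have -> : b s = \sum_(m < n.+1) a m * K s m.
  rewrite bE [RHS](bigID (fun m : 'I_n.+1 => (m < s.+1)%N)) /=.
  rewrite [X in _ + X]big1 ?addr0; last first.
    by move=> m; rewrite -leqNgt => lt_sm; rewrite K0 ?mulr0.
  rewrite -(big_mkord xpredT (fun m => a m * K s m)).
  rewrite -(big_mkord (fun m => m < s.+1)%N (fun m => a m * K s m)).
  by rewrite [RHS]big_mkcond /= (big_nat_widen _ _ n.+1) ?big_mkcond //=.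
by rewrite mulr_sumr; apply: eq_bigr => m _; rewrite mulrCA.
Qed.

Lemma bstepD (F : fieldType) (q : F) (W b b' : nat -> F) n :
  bstep q W (fun s => b s + b' s) n = bstep q W b n + bstep q W b' n.
Proof. by rewrite /bstep -big_split; apply: eq_bigr => s _; rewrite mulrDr. Qed.

Lemma eq_bstep (F : fieldType) (q : F) (W W' b b' : nat -> F) n :
  (forall s, (s <= n)%N -> W s * b s = W' s * b' s) -> bstep q W b n = bstep q W' b' n.
Proof.
move=> e; apply: eq_bigr => s _.
by rewrite ![_ / _ * _]mulrAC e // -ltnS.
Qed.

(** Since (m + l)^2 + c (m + l) = m^2 + c m + l^2 + (2 m + c) l, the Vandermonde weight splits off
    and the kernel is an eigenfunction. *)
Lemma bstep_kern_sq (F : fieldType) (q : F) c n m : qregular q ->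
  bstep q (fun s => q ^+ (s ^ 2 + c * s)) (kern q c ^~ m) n
  = q ^+ (m ^ 2 + c * m) * kern q c n m.
Proof.
move=> hq; have [le_mn|lt_nm] := leqP m n; last first.
  by rewrite bstep_kern_small // kern_small ?mulr0.
rewrite bstep_kern // /kern le_mn.
have -> : (n + m + c = 2 * m + c + (n - m))%N by lia.
rewrite -q_vandermonde_sq // mulr_sumr; apply: eq_bigr => l _.
rewrite mulrA -exprD; congr (q ^+ _ / _); nia.
Qed.

(** The case c = 0 divided by q^m, without negative powers: s^2 - m can truncate only for s < m,
    where the kernel vanishes. *)
Lemma bstep_kern_sq_shift (F : fieldType) (q : F) n m : qregular q ->
  bstep q (fun s => q ^+ (s ^ 2 - m)) (kern q 0 ^~ m) n
  = q ^+ (m ^ 2 - m) * kern q 0 n m.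
Proof.
move=> hq; have [le_mn|lt_nm] := leqP m n; last first.
  by rewrite bstep_kern_small // kern_small ?mulr0.
rewrite bstep_kern // /kern le_mn.
have -> : (n + m + 0 = 2 * m + 0 + (n - m))%N by lia.
rewrite -q_vandermonde_sq // mulr_sumr; apply: eq_bigr => l _.
rewrite mulrA -exprD; congr (q ^+ _ / _).
have : (m <= m ^ 2)%N by nia.
nia.
Qed.

Lemma kern1E (F : fieldType) (q : F) n m : qregular q ->
  kern q 1 n m = (1 - q ^+ (n.+1 - m)) * kern q 0 n.+1 m.
Proof.
move=> hq; have [le_mn|lt_nm] := leqP m n; last first.
  rewrite kern_small //; have [->|ne] := eqVneq m n.+1.
    by rewrite subnn expr0 subrr mul0r.
  by rewrite kern_small ?mulr0 //; lia.
rewrite /kern le_mn leqW // subSn // qpS -exprS addn0 addn1 -addSn.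
have h1 := qp_neq0 (n - m) hq; have h2 := qp_neq0 (n.+1 + m) hq.
have h3 : 1 - q ^+ (n - m).+1 != 0 by rewrite subr_eq0 eq_sym; case: hq.
by field; rewrite h1 h2 h3.
Qed.

(* Splits [1 = (1 - q^(s-m)) + q^(s-m)]: the first part lowers [s - m], hence
   trades [kern q 0] for [kern q 1]. *)
Lemma bstep_kern_split (F : fieldType) (q : F) (W W' : nat -> F) n m : qregular q ->
  (forall s, (m <= s)%N -> W' s = W s * q ^+ (s - m)) ->
  bstep q W (kern q 0 ^~ m) n =
  (if n is n'.+1 then bstep q (fun s => W s.+1) (kern q 1 ^~ m) n' else 0)
  + bstep q W' (kern q 0 ^~ m) n.
Proof.
move=> hq hW.
have -> : bstep q W (kern q 0 ^~ m) n =
    bstep q W (fun s => (1 - q ^+ (s - m)) * kern q 0 s m) n + bstep q W' (kern q 0 ^~ m) n.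
  rewrite (_ : bstep q W' _ n = bstep q W (fun s => q ^+ (s - m) * kern q 0 s m) n).
    by rewrite -bstepD; apply: eq_bstep => s _; congr (_ * _); ring.
  apply: eq_bstep => s _; have [le_ms|lt_sm] := leqP m s; last first.
    by rewrite kern_small // !mulr0.
  by rewrite hW // mulrA.
congr (_ + _); case: n => [|n].
  rewrite /bstep big_ord_recl big_ord0 addr0 /= sub0n expr0 subrr mul0r mulr0 //.
rewrite /bstep big_ord_recl /= sub0n expr0 subrr mul0r mulr0 add0r.
by apply: eq_bigr => s _; rewrite /bump /= add1n subSS kern1E.
Qed.

(** In the split, the first part carries q^((s+1)^2-(s+1)) = q^(s^2+s), the diagonal weight of
    [kern q 1], and the second q^(s^2-m). With x = q^m, the factors of q^(m^2-m) add up to x^2 (1 -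
    q^(n-m)) + 1 = 1 + x^2 - x q^n. *)
Lemma bstep_kern_minus (F : fieldType) (q : F) n m : qregular q ->
  bstep q (fun s => q ^+ (s ^ 2 - s)) (kern q 0 ^~ m) n
  = q ^+ (m ^ 2 - m) * (1 + q ^+ m ^+ 2 - q ^+ m * q ^+ n) * kern q 0 n m.
Proof.
move=> hq; have [le_mn|lt_nm] := leqP m n; last first.
  by rewrite bstep_kern_small // kern_small ?mulr0.
rewrite (bstep_kern_split _ (W' := fun s => q ^+ (s ^ 2 - m)) hq); last first.
  move=> s le_ms; rewrite -exprD; congr (_ ^+ _).
  have : (s <= s ^ 2)%N by nia.
  lia.
rewrite bstep_kern_sq_shift //.
case: n le_mn => [|n] le_mn.
  by case: m le_mn => // _; rewrite !expr0; ring.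
have -> : bstep q (fun s => q ^+ (s.+1 ^ 2 - s.+1)) (kern q 1 ^~ m) n
   = bstep q (fun s => q ^+ (s ^ 2 + 1 * s)) (kern q 1 ^~ m) n.
  by apply: eq_bstep => s _; congr (_ ^+ _ * _); nia.
rewrite bstep_kern_sq // kern1E //.
have -> : q ^+ (m ^ 2 + 1 * m) = q ^+ (m ^ 2 - m) * q ^+ m ^+ 2.
  rewrite -exprM -exprD; congr (_ ^+ _).
  have : (m <= m ^ 2)%N by nia.
  lia.
have -> : q ^+ n.+1 = q ^+ m * q ^+ (n.+1 - m) by rewrite -exprD subnKC.
ring.
Qed.

(** * Bailey steps with the weight of s_1 *)

Lemma qpN1 (F : fieldType) (q : F) n : qp (-1) q n.+1 = 2 * qp (- q) q n.
Proof. by rewrite qpSl mulN1r opprK. Qed.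

Lemma qpN1_div (F : fieldType) (q : F) n : qregular q ->
  qp (-1) q n = 2 * qp (- q) q n / (1 + q ^+ n).
Proof.
move=> hq; apply: (mulIf (qregular_neq0 n hq)); rewrite mulfVK ?qregular_neq0 //.
by rewrite -qpN1 qpS mulN1r opprK.
Qed.

Lemma qpNq_split (F : fieldType) (q : F) m n : (m <= n)%N ->
  qp (- q) q n = qp (- q) q m * qp (- q ^+ m.+1) q (n - m).
Proof. by move=> le_mn; rewrite -{1}(subnKC le_mn) qpD mulNr -exprS. Qed.

Lemma bin2D m l : ('C(m + l, 2) = 'C(m, 2) + 'C(l, 2) + m * l)%N.
Proof.
elim: l => [|l IH]; first by rewrite addn0 muln0 !addn0.
by rewrite addnS !binS !bin1 IH; nia.
Qed.

(** With s = m + l, (-1)_s = (-1)_m (- q^m)_l, and the Vandermonde sum has u = m + 1, v = m. Its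
    value (- q^(m+1))_(n-m) recombines with (-1)_m = 2 (- q)_m / (1 + q^m) to (- q)_n. *)
Lemma bstep_kern_final_shift (F : fieldType) (q : F) n m : qregular q ->
  bstep q (fun s => q ^+ ('C(s.+1, 2) - m) * qp (-1) q s) (kern q 0 ^~ m) n
  = qp (- q) q n * (2 * q ^+ 'C(m, 2) / (1 + q ^+ m)) * kern q 0 n m.
Proof.
move=> hq; have [le_mn|lt_nm] := leqP m n; last first.
  by rewrite bstep_kern_small // kern_small ?mulr0.
rewrite bstep_kern // /kern le_mn.
have -> : (n + m + 0 = 2 * m + 0 + (n - m))%N by lia.
rewrite (qpNq_split _ le_mn).
transitivity (q ^+ 'C(m, 2) * qp (-1) q m * (qp (- q ^+ m.+1) q (n - m) /
    (qp q q (n - m) * qp q q (2 * m + 0 + (n - m))))); last first.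
  by rewrite qpN1_div //; field; rewrite !qp_neq0 // qregular_neq0.
rewrite -(@q_vandermonde_pair _ q _ m.+1 m) //; last by lia.
rewrite mulr_sumr; apply: eq_bigr => l _.
rewrite qpD mulN1r !mulrA; congr (_ / _).
rewrite -(mulrA (q ^+ 'C(m, 2))) (mulrC (qp (-1) q m)) !mulrA -exprD.
congr (q ^+ _ * _ * _).
by rewrite binS bin1 bin2D; nia.
Qed.

Lemma bstep_kern_final (F : fieldType) (q : F) n m : qregular q ->
  bstep q (fun s => q ^+ 'C(s.+1, 2) * qp (-1) q s) (kern q 0 ^~ m) n
  = qp (- q) q n * (2 * q ^+ 'C(m, 2) * q ^+ m / (1 + q ^+ m)) * kern q 0 n m.
Proof.
move=> hq; transitivity (q ^+ m * bstep q
    (fun s => q ^+ ('C(s.+1, 2) - m) * qp (-1) q s) (kern q 0 ^~ m) n).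
  rewrite /bstep mulr_sumr; apply: eq_bigr => s _.
  have [le_ms|lt_sm] := leqP m s; last by rewrite kern_small // !mulr0.
  rewrite -(subnKC (_ : m <= 'C(s.+1, 2))%N) ?exprD ?addKn; first by ring.
  by rewrite binS bin1; lia.
rewrite bstep_kern_final_shift //; ring.
Qed.

(** Here u = v = m + 1, and (-1)_(m+1) = 2 (- q)_m leaves no denominator. *)
Lemma bstep_kern1_final (F : fieldType) (q : F) n m : qregular q ->
  bstep q (fun s => q ^+ 'C(s.+1, 2) * qp (-1) q s.+1) (kern q 1 ^~ m) n
  = qp (- q) q n * (2 * q ^+ 'C(m, 2) * q ^+ m) * kern q 1 n m.
Proof.
move=> hq; have [le_mn|lt_nm] := leqP m n; last first.
  by rewrite bstep_kern_small // kern_small ?mulr0.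
rewrite bstep_kern // /kern le_mn.
have -> : (n + m + 1 = 2 * m + 1 + (n - m))%N by lia.
rewrite (qpNq_split _ le_mn).
transitivity (q ^+ 'C(m.+1, 2) * qp (-1) q m.+1 * (qp (- q ^+ m.+1) q (n - m) /
    (qp q q (n - m) * qp q q (2 * m + 1 + (n - m))))); last first.
  by rewrite qpN1 binS bin1 exprD; ring.
rewrite -(@q_vandermonde_pair _ q _ m.+1 m.+1) //; last by lia.
rewrite mulr_sumr; apply: eq_bigr => l _.
rewrite -addSn qpD mulN1r !mulrA; congr (_ / _).
rewrite -(mulrA (q ^+ 'C(m.+1, 2))) (mulrC (qp (-1) q m.+1)) !mulrA -exprD.
congr (q ^+ _ * _ * _).
by rewrite bin2D; nia.
Qed.

(** In the split, the part with [kern q 1] lives at level n - 1 and brings (- q)_(n-1) = (- q)_n /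
    (1 + q^n); this denominator is the origin of the defect. *)
Lemma bstep_kern_final_minus (F : fieldType) (q : F) n m : qregular q ->
  bstep q (fun s => q ^+ 'C(s, 2) * qp (-1) q s) (kern q 0 ^~ m) n
  = qp (- q) q n * (2 * q ^+ 'C(m, 2) / (1 + q ^+ m)
       + 2 * q ^+ 'C(m, 2) * (q ^+ m - q ^+ n) / (1 + q ^+ n)) * kern q 0 n m.
Proof.
move=> hq; have [le_mn|lt_nm] := leqP m n; last first.
  by rewrite bstep_kern_small // kern_small ?mulr0.
rewrite (bstep_kern_split _ (W' := fun s => q ^+ ('C(s.+1, 2) - m) * qp (-1) q s) hq); last first.
  move=> s le_ms; rewrite mulrAC -exprD; congr (_ ^+ _ * _).
  by rewrite binS bin1; lia.
rewrite bstep_kern_final_shift //.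
case: n le_mn => [|n] le_mn.
  by case: m le_mn => // _; rewrite !expr0; ring.
rewrite bstep_kern1_final // kern1E //.
have -> : q ^+ n.+1 = q ^+ m * q ^+ (n.+1 - m) by rewrite -exprD subnKC.
have -> : qp (- q) q n.+1 = qp (- q) q n * (1 + q ^+ m * q ^+ (n.+1 - m)).
  by rewrite qpS mulNr opprK -exprS -exprD subnKC.
have h := qregular_neq0 m hq.
have h' : 1 + q ^+ m * q ^+ (n.+1 - m) != 0 by rewrite -exprD subnKC // qregular_neq0.
by field; rewrite h h'.
Qed.

(** * The unit Bailey pair and the passage from a = q to a = 1 *)

Lemma unit_partial (F : fieldType) (q : F) n M : qregular q -> (M < n)%N ->
  (1 - q ^+ n) * (\sum_(m < M.+1) (-1) ^+ m * q ^+ 'C(m, 2) *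
     (1 - q ^+ (2 * m + 1)) * kern q 1 n m)
  = (-1) ^+ M * q ^+ 'C(M.+1, 2) * (1 - q ^+ M.+1) /
     (qp q q (n - M.+1) * qp q q (n + M.+1)).
Proof.
move=> hq; elim: M => [|M IH] lt_Mn.
  rewrite big_ord_recl big_ord0 /kern /= expr0 expr1 !mul1r addr0 subn0 !addn0.
  case: n lt_Mn => // n _; rewrite subSS subn0 (qpS _ _ n) -exprS.
  have h1 := qp_neq0 n hq; have h2 := qp_neq0 (n.+1 + 1) hq.
  have h3 : 1 - q ^+ n.+1 != 0 by rewrite subr_eq0 eq_sym; case: hq.
  by field; rewrite h1 h2 h3.
rewrite big_ord_recr /= mulrDr IH; last by lia.
rewrite /kern ltnW //.
rewrite (_ : (n + M.+1 + 1 = (n + M.+1).+1)%N); last by lia.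
rewrite (_ : (n + M.+2 = (n + M.+1).+1)%N); last by lia.
rewrite (_ : (n - M.+1 = (n - M.+2).+1)%N); last by lia.
rewrite !qpS -!exprS.
have h1 := qp_neq0 (n - M.+2) hq; have h2 := qp_neq0 (n + M.+1) hq.
have h3 l : 1 - q ^+ l.+1 != 0 by rewrite subr_eq0 eq_sym; case: hq.
have h4 := h3 (n - M.+2)%N; have h5 := h3 (n + M.+1)%N.
have e1 : q ^+ n = q ^+ M.+1 * q ^+ (n - M.+2).+1.
  by rewrite -exprD; congr (_ ^+ _); lia.
have e2 : q ^+ (n + M.+1).+1 = q ^+ M.+2 * q ^+ M.+1 * q ^+ (n - M.+2).+1.
  by rewrite -!exprD; congr (_ ^+ _); lia.
have e3 : q ^+ 'C(M.+2, 2) = q ^+ 'C(M.+1, 2) * q ^+ M.+1 by rewrite -exprD binS bin1.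
have e4 : q ^+ (2 * M.+1 + 1) = q ^+ M.+2 * q ^+ M.+1.
  by rewrite -exprD; congr (_ ^+ _); lia.
move: h5; rewrite e1 e2 e3 e4 (exprS (-1)) => h5.
by field; rewrite h1 h2 h4 h5.
Qed.

(** The partial sums have a closed form once multiplied by 1 - q^n, and for n > 0 the one up to n -
    1 cancels the last term. *)
Lemma unit_pair (F : fieldType) (q : F) n : qregular q ->
  \sum_(m < n.+1) (-1) ^+ m * q ^+ 'C(m, 2) * (1 - q ^+ (2 * m + 1)) * kern q 1 n m
  = (n == 0%N)%:R.
Proof.
move=> hq; case: n => [|n].
  rewrite big_ord_recl big_ord0 /kern /= !expr0 expr1 !mul1r addr0.
  rewrite qpS qp0 expr0 mulr1 !mul1r divff //.
  by rewrite -[q]expr1 subr_eq0 eq_sym; case: hq.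
have h3 l : 1 - q ^+ l.+1 != 0 by rewrite subr_eq0 eq_sym; case: hq.
apply: (mulfI (h3 n)); rewrite mulr0 big_ord_recr /= mulrDr unit_partial //.
rewrite /kern leqnn subnn.
have -> : (2 * n.+1 + 1 = (n.+1 + n.+1).+1)%N by lia.
rewrite [(n.+1 + n.+1 + 1)%N]addn1 qpS -exprS qp0 mul1r.
have h2 := qp_neq0 (n.+1 + n.+1) hq; have h5 := h3 (n.+1 + n.+1)%N.
rewrite (exprS (-1)).
by field; rewrite h2 h5.
Qed.

(* Folds a bilateral sum over [m] into a sum over [m >= 0] of the terms [m] and [-m]. *)
Definition half_at0 (F : fieldType) (m : nat) : F := if m is 0 then 2^-1 else 1.

(** Over the common denominator (q)_(n-m) (q)_(n+m+1), the numerators satisfy (1 - q^(n+m+1)) -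
    q^(2m+1) (1 - q^(n-m)) = 1 - q^(2m+1). *)
Lemma kern1_kern0 (F : fieldType) (q : F) n m : qregular q ->
  (1 - q ^+ (2 * m + 1)) * kern q 1 n m
  = kern q 0 n m - q ^+ (2 * m + 1) * kern q 0 n m.+1.
Proof.
move=> hq; have h3 l : 1 - q ^+ l.+1 != 0 by rewrite subr_eq0 eq_sym; case: hq.
have [lt_nm|lt_mn|eq_mn] := ltngtP n m.
- by rewrite !kern_small ?mulr0 ?subrr //; lia.
- rewrite /kern ltnW // lt_mn (_ : n - m = (n - m.+1).+1)%N; last by lia.
  rewrite (_ : n + m + 1 = (n + m).+1)%N; last by lia.
  rewrite (_ : n + m + 0 = n + m)%N; last by lia.
  rewrite (_ : n + m.+1 + 0 = (n + m).+1)%N; last by lia.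
  rewrite !qpS -!exprS.
  have h1 := qp_neq0 (n - m.+1) hq; have h2 := qp_neq0 (n + m) hq.
  have h4 := h3 (n - m.+1)%N; have h5 := h3 (n + m)%N.
  have e1 : q ^+ (n + m).+1 = q ^+ (2 * m + 1) * q ^+ (n - m.+1).+1.
    by rewrite -exprD; congr (_ ^+ _); lia.
  move: h5; rewrite e1 => h5.
  by field; rewrite h1 h2 h4 h5.
- rewrite eq_mn (kern_small _ _ (ltnSn m)) mulr0 subr0 /kern leqnn subnn addn0.
  have -> : (2 * m + 1 = (m + m).+1)%N by lia.
  rewrite [(m + m + 1)%N]addn1 !qpS -exprS.
  have h2 := qp_neq0 (m + m) hq; have h5 := h3 (m + m)%N.
  by field; rewrite qp0 h2 h5 oner_neq0.
Qed.

Lemma half_at0D (F : fieldType) (q : F) (c : F) : qregular q -> half_at0 F 0 * (c + c) = c.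
Proof.
move=> hq; have := qregular_neq0 0 hq; rewrite expr0 => h.
by rewrite /half_at0; field.
Qed.

(** The second term of [kern1_kern0] at m contributes to the index m + 1. When c is given by a
    formula that extends to all integers, c' m stands for c (-m), by the symmetry c (-m-1) =
    q^(2m+1) c m. *)
Lemma kern1_sum (F : fieldType) (q : F) (c c' : nat -> F) n : qregular q ->
  c' 0%N = c 0%N -> (forall m, c' m.+1 = q ^+ (2 * m + 1) * c m) ->
  \sum_(m < n.+1) (-1) ^+ m * c m * ((1 - q ^+ (2 * m + 1)) * kern q 1 n m)
  = \sum_(m < n.+1) half_at0 F m * (-1) ^+ m * (c m + c' m) * kern q 0 n m.
Proof.
move=> hq c0 cS.
under eq_bigr => m _ do rewrite kern1_kern0 // mulrBr.
rewrite sumrB big_ord_recl [RHS]big_ord_recl /= c0.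
rewrite [X in _ - X]big_ord_recr /= (kern_small _ _ (ltnSn n)) !mulr0 addr0.
rewrite -addrA -sumrB expr0 !mul1r mulr1 (half_at0D _ hq); congr (_ + _).
apply: eq_bigr => m _; rewrite /bump /= add1n cS (exprS (-1)); ring.
Qed.

(** * Iterated Bailey steps: the inner sums *)

Fixpoint nest (F : fieldType) (q : F) (W : nat -> nat -> F) (d i : nat) : nat -> F :=
  if d is d'.+1 then bstep q (W i) (nest q W d' i.+1) else fun n => (qp q q n)^-1.

Definition sgn_half (F : fieldType) (m : nat) : F := half_at0 F m * (-1) ^+ m.

Lemma sqr_binE (F : fieldType) (q : F) m : q ^+ (m ^ 2) = q ^+ 'C(m, 2) ^+ 2 * q ^+ m.
Proof.
rewrite -exprM -exprD; congr (_ ^+ _).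
by have := mul_bin_diag m 1; rewrite bin1; case: m => [|m] /=; nia.
Qed.

Lemma sqr_minus_binE (F : fieldType) (q : F) m : q ^+ (m ^ 2 - m) = q ^+ 'C(m, 2) ^+ 2.
Proof.
rewrite -exprM; congr (_ ^+ _).
by have := mul_bin_diag m 1; rewrite bin1; case: m => [|m] /=; nia.
Qed.

Lemma sqr_plus_binE (F : fieldType) (q : F) m :
  q ^+ (m ^ 2 + 1 * m) = q ^+ 'C(m, 2) ^+ 2 * q ^+ m ^+ 2.
Proof. by rewrite exprD sqr_binE mul1n -mulrA -expr2. Qed.

Lemma binS_E (F : fieldType) (q : F) m : q ^+ 'C(m.+1, 2) = q ^+ 'C(m, 2) * q ^+ m.
Proof. by rewrite -exprD binS bin1. Qed.

Lemma nest_plus (F : fieldType) (q : F) (W : nat -> nat -> F) d i n : qregular q ->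
  (forall i' s, (i <= i' < i + d)%N -> W i' s = q ^+ (s ^ 2 + 1 * s)) ->
  nest q W d i n = \sum_(m < n.+1) (-1) ^+ m *
     (q ^+ 'C(m, 2) * (q ^+ 'C(m, 2) ^+ 2 * q ^+ m ^+ 2) ^+ d.+1) *
     ((1 - q ^+ (2 * m + 1)) * kern q 1 n m).
Proof.
move=> hq; elim: d i n => [|d IH] i n hW.
  (* The innermost 1 / (q)_n is itself a step applied to [n = 0], for any weight equal to 1 at s =
     0; taking the diagonal one explains the exponent [d.+1]. *)
  have -> : nest q W 0 i n = bstep q (fun s => q ^+ (s ^ 2 + 1 * s)) (fun s => (s == 0%N)%:R) n.
    rewrite /bstep big_ord_recl /= big1 ?addr0 => [|s _]; last by rewrite mulr0.
    by rewrite mulr1 subn0 expr0 mul1r.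
  rewrite (bstep_expand (K := kern q 1)
    (a := fun m => (-1) ^+ m * q ^+ 'C(m, 2) * (1 - q ^+ (2 * m + 1))) _ (fun n m => bstep_kern_sq 1 n m hq)
    (fun n => esym (unit_pair n hq))); last exact: kern_small.
  by apply: eq_bigr => m _; rewrite sqr_plus_binE expr1; ring.
have IH' s : nest q W d i.+1 s = \sum_(m < s.+1) (-1) ^+ m *
     (q ^+ 'C(m, 2) * (q ^+ 'C(m, 2) ^+ 2 * q ^+ m ^+ 2) ^+ d.+1) *
     (1 - q ^+ (2 * m + 1)) * kern q 1 s m.
  rewrite IH; last by move=> i' s' hi; apply: hW; lia.
  by apply: eq_bigr => m _; rewrite mulrA.
rewrite /= (_ : bstep _ _ _ _ = bstep q (fun s => q ^+ (s ^ 2 + 1 * s)) (nest q W d i.+1) n);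
  last by apply: eq_bstep => s _; rewrite hW //; lia.
rewrite (bstep_expand (K := kern q 1)
  (a := fun m => (-1) ^+ m * (q ^+ 'C(m, 2) * (q ^+ 'C(m, 2) ^+ 2 * q ^+ m ^+ 2) ^+ d.+1) *
     (1 - q ^+ (2 * m + 1))) _ (fun n m => bstep_kern_sq 1 n m hq) IH'); last exact: kern_small.
by apply: eq_bigr => m _; rewrite sqr_plus_binE (exprS _ d.+1); ring.
Qed.

(** With p = q^'C(m, 2) and x = q^m, the summands p^(2d+3) x and p^(2d+3) x^(2d+2) come from the
    indices - m and m of a bilateral series. *)
Definition acoef (F : fieldType) (q : F) (d m : nat) : F :=
  sgn_half F m * (q ^+ 'C(m, 2) * q ^+ 'C(m, 2) ^+ (2 * d.+1) * q ^+ m *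
    (1 + q ^+ m ^+ (2 * d + 1))).

(** A change of basis: the weights still to come, q^(s^2) and q^(s^2-s), act on [kern q 0]. *)
Lemma nest_plus0 (F : fieldType) (q : F) (W : nat -> nat -> F) d i n : qregular q ->
  (forall i' s, (i <= i' < i + d)%N -> W i' s = q ^+ (s ^ 2 + 1 * s)) ->
  nest q W d i n = \sum_(m < n.+1) acoef q d m * kern q 0 n m.
Proof.
move=> hq hW; rewrite (nest_plus _ hq hW).
rewrite (kern1_sum
  (c := fun m => q ^+ 'C(m, 2) * (q ^+ 'C(m, 2) ^+ 2 * q ^+ m ^+ 2) ^+ d.+1)
  (c' := fun m => q ^+ 'C(m, 2) * q ^+ m * (q ^+ 'C(m, 2) ^+ 2) ^+ d.+1)) //.
- apply: eq_bigr => m _; congr (_ * _); rewrite /acoef /sgn_half exprMn -!exprM.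
  have -> : (m * 2 * d.+1 = m + m * (2 * d + 1))%N by lia.
  by rewrite (exprD q m (m * _)) -(mulnA 'C(m, 2) 2); ring.
- by rewrite !expr0 mulr1 expr1n mulr1 !mul1r.
- move=> m; rewrite binS_E (_ : q ^+ (2 * m + 1) = q ^+ m * q ^+ m.+1); last first.
    by rewrite -exprD; congr (_ ^+ _); lia.
  by rewrite !exprMn (exprS q m); ring.
Qed.

Lemma nest_zero (F : fieldType) (q : F) (W : nat -> nat -> F) d z i n : qregular q ->
  (forall i' s, (i <= i' < i + z)%N -> W i' s = q ^+ (s ^ 2)) ->
  (forall i' s, (i + z <= i' < i + z + d)%N -> W i' s = q ^+ (s ^ 2 + 1 * s)) ->
  nest q W (z + d) i n = \sum_(m < n.+1)
    acoef q d m * (q ^+ 'C(m, 2) ^+ 2 * q ^+ m) ^+ z * kern q 0 n m.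
Proof.
move=> hq; elim: z i n => [|z IH] i n hW0 hW1.
  rewrite nest_plus0 //; last by move=> i' s hi; apply: hW1; lia.
  by apply: eq_bigr => m _; rewrite expr0 mulr1.
rewrite addSn /= (_ : bstep _ _ _ _ = bstep q (fun s => q ^+ (s ^ 2 + 0 * s)) (nest q W (z + d) i.+1) n);
  last by apply: eq_bstep => s _; rewrite hW0 ?mul0n ?addn0 //; lia.
have IH' s : nest q W (z + d) i.+1 s = \sum_(m < s.+1)
    acoef q d m * (q ^+ 'C(m, 2) ^+ 2 * q ^+ m) ^+ z * kern q 0 s m.
  by apply: IH => i' s' hi; [apply: hW0|apply: hW1]; lia.
rewrite (bstep_expand (K := kern q 0)
  (a := fun m => acoef q d m * (q ^+ 'C(m, 2) ^+ 2 * q ^+ m) ^+ z) _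
  (fun n m => bstep_kern_sq 0 n m hq) IH'); last exact: kern_small.
by apply: eq_bigr => m _; rewrite mul0n addn0 sqr_binE (exprS _ z); ring.
Qed.

(** * Steps with weight q^(s^2-s) and Chebyshev polynomials *)

Definition geo (F : fieldType) (x : F) (n : nat) : F := \sum_(l < n) x ^+ l.

Lemma geoS (F : fieldType) (x : F) n : geo x n.+1 = geo x n + x ^+ n.
Proof. by rewrite /geo big_ord_recr. Qed.

Lemma geo_odd (F : fieldType) (x : F) n :
  geo x (2 * n + 1) = geo (x ^+ 2) n.+1 + x * geo (x ^+ 2) n.
Proof.
elim: n => [|n IH]; first by rewrite muln0 add0n !geoS /geo !big_ord0; ring.
have -> : (2 * n.+1 + 1 = (2 * n + 1).+2)%N by lia.
rewrite 2!geoS IH (geoS _ n.+1) (geoS _ n) -!exprM addn1 mulnS !exprS; ring.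
Qed.

(** At x^2 in place of x, the recursion of the Chebyshev polynomials of the second kind: for x != 0,
    [geo (x ^+ 2) t.+1] is x^t U_t((x + 1/x) / 2). *)
Lemma geo_rec (F : fieldType) (x : F) n : geo x n.+2 = (1 + x) * geo x n.+1 - x * geo x n.
Proof. by rewrite 2!geoS exprS; ring. Qed.

(** The image of [kern q 0] after t steps with weight q^(s^2-s). It stays in the span of K and q^n K
    because q^s q^(s^2-s) = q^(s^2) is a diagonal weight. *)
Definition minus_kern (F : fieldType) (q : F) (t n m : nat) : F :=
  q ^+ 'C(m, 2) ^+ (2 * t) *
  (geo (q ^+ m ^+ 2) t.+1 - q ^+ m * geo (q ^+ m ^+ 2) t * q ^+ n) * kern q 0 n m.

Lemma minus_kern_small (F : fieldType) (q : F) t n m : (n < m)%N -> minus_kern q t n m = 0.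
Proof. by move=> lt_nm; rewrite /minus_kern kern_small ?mulr0. Qed.

(* [A + B q^n] is mapped to [p^2 ((1 + x^2) A + x B) - p^2 x A q^n], where [x = q^m]
   and [p^2 = q^(m^2-m)]; this is the recursion of the Chebyshev polynomials. *)
Lemma bstep_minus_kern (F : fieldType) (q : F) t n m : qregular q ->
  bstep q (fun s => q ^+ (s ^ 2 - s)) (minus_kern q t ^~ m) n = minus_kern q t.+1 n m.
Proof.
move=> hq; pose P := q ^+ 'C(m, 2) ^+ (2 * t).
pose A := geo (q ^+ m ^+ 2) t.+1; pose B := q ^+ m * geo (q ^+ m ^+ 2) t.
transitivity (P * A * bstep q (fun s => q ^+ (s ^ 2 - s)) (kern q 0 ^~ m) n
   - P * B * bstep q (fun s => q ^+ (s ^ 2 + 0 * s)) (kern q 0 ^~ m) n).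
  rewrite /bstep [X in _ = X - _]mulr_sumr [X in _ = _ - X]mulr_sumr -sumrB; apply: eq_bigr => s _.
  have -> : q ^+ (s ^ 2 + 0 * s) = q ^+ (s ^ 2 - s) * q ^+ s.
    rewrite -exprD; congr (_ ^+ _).
    have : (s <= s ^ 2)%N by nia.
    lia.
  by rewrite /minus_kern -/P -/A -/B; ring.
rewrite bstep_kern_minus // bstep_kern_sq // mul0n addn0 sqr_binE sqr_minus_binE.
rewrite /minus_kern geo_rec mulnS exprD -/P -/A /B; ring.
Qed.

Lemma nest_minus (F : fieldType) (q : F) (W : nat -> nat -> F) d z t i n : qregular q ->
  (forall i' s, (i <= i' < i + t)%N -> W i' s = q ^+ (s ^ 2 - s)) ->
  (forall i' s, (i + t <= i' < i + t + z)%N -> W i' s = q ^+ (s ^ 2)) ->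
  (forall i' s, (i + t + z <= i' < i + t + z + d)%N -> W i' s = q ^+ (s ^ 2 + 1 * s)) ->
  nest q W (t + (z + d)) i n = \sum_(m < n.+1)
    acoef q d m * (q ^+ 'C(m, 2) ^+ 2 * q ^+ m) ^+ z * minus_kern q t n m.
Proof.
move=> hq; elim: t i n => [|t IH] i n hWm hW0 hW1.
  rewrite add0n (@nest_zero _ _ _ d z) //.
  - apply: eq_bigr => m _; congr (_ * _).
    by rewrite /minus_kern geoS /geo !big_ord0 !expr0; ring.
  - by move=> i' s hi; apply: hW0; lia.
  - by move=> i' s hi; apply: hW1; lia.
rewrite addSn /= (_ : bstep _ _ _ _ = bstep q (fun s => q ^+ (s ^ 2 - s)) (nest q W (t + (z + d)) i.+1) n);
  last by apply: eq_bstep => s _; rewrite hWm //; lia.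
have IH' s : nest q W (t + (z + d)) i.+1 s = \sum_(m < s.+1)
    acoef q d m * (q ^+ 'C(m, 2) ^+ 2 * q ^+ m) ^+ z * minus_kern q t s m.
  by apply: IH => i' s' hi; [apply: hWm|apply: hW0|apply: hW1]; lia.
rewrite (bstep_expand (K := minus_kern q t)
  (a := fun m => acoef q d m * (q ^+ 'C(m, 2) ^+ 2 * q ^+ m) ^+ z) _
  (fun n m => bstep_minus_kern t n m hq) IH') //.
exact: minus_kern_small.
Qed.

(** * The finite identity *)

Definition head_exp (k j r s : nat) : nat := ('C(s.+1, 2) - (0 < j) * s + (k <= r) * s)%N.

(** Neither this subtraction nor that of [head_exp] truncates, as s <= s^2 and s <= 'C(s+1, 2). In
    [head_exp], [k <= r] is the condition k - r < i at i = 1. *)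
Definition tail_exp (k j r i s : nat) : nat := (s ^ 2 - (i <= j) * s + (k - r < i) * s)%N.

Definition head_weight (F : fieldType) (q : F) (k j r s : nat) : F :=
  q ^+ head_exp k j r s * qp (-1) q s.

Definition tail_weight (F : fieldType) (q : F) (k j r i s : nat) : F :=
  q ^+ tail_exp k j r i s.

(* With [x = q^m] and [q^(m^2-m) = (q^'C(m, 2))^2], so that all exponents are natural
   numbers and [q = 0] needs no separate treatment. *)
Definition target (F : fieldType) (q : F) (k j r m : nat) : F :=
  sgn_half F m * 2 * q ^+ 'C(m, 2) ^+ (2 * k.+1) * q ^+ m ^+ (k.+1 - r - j)
  * geo (q ^+ m) (2 * j + 1) * (1 + q ^+ m ^+ (2 * r + 1)) / (1 + q ^+ m).

(* What is left over at finite level; it comes multiplied by [q^n / (1 + q^n)]. *)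
Definition defect (F : fieldType) (q : F) (k j r m : nat) : F :=
  acoef q r m * ((q ^+ 'C(m, 2) ^+ 2 * q ^+ m) ^+ (k - r - j)
    * q ^+ 'C(m, 2) ^+ (2 * j.-1) * (2 * q ^+ 'C(m, 2))
    * geo (q ^+ m ^+ 2) j * (1 + q ^+ m)).

(** As (x - q^n) / (1 + q^n) = x - (1 + x) q^n / (1 + q^n), the part that vanishes in the limit
    separates. The rest has numerator (1 + x + x^2) [A] - x [B], which the recursion turns into the
    odd geometric sum in x. *)
Lemma bstep_minus_kern_final (F : fieldType) (q : F) t n m : qregular q ->
  bstep q (fun s => q ^+ 'C(s, 2) * qp (-1) q s) (minus_kern q t ^~ m) n =
  qp (- q) q n * (q ^+ 'C(m, 2) ^+ (2 * t) * (2 * q ^+ 'C(m, 2)) *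
    (geo (q ^+ m) (2 * t.+1 + 1) / (1 + q ^+ m)
     - geo (q ^+ m ^+ 2) t.+1 * (1 + q ^+ m) * (q ^+ n / (1 + q ^+ n)))) * kern q 0 n m.
Proof.
move=> hq; pose P := q ^+ 'C(m, 2) ^+ (2 * t).
pose A := geo (q ^+ m ^+ 2) t.+1; pose B := q ^+ m * geo (q ^+ m ^+ 2) t.
transitivity (P * A * bstep q (fun s => q ^+ 'C(s, 2) * qp (-1) q s) (kern q 0 ^~ m) n
   - P * B * bstep q (fun s => q ^+ 'C(s.+1, 2) * qp (-1) q s) (kern q 0 ^~ m) n).
  rewrite /bstep [X in _ = X - _]mulr_sumr [X in _ = _ - X]mulr_sumr -sumrB.
  by apply: eq_bigr => s _; rewrite /minus_kern -/P -/A -/B binS_E; ring.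
rewrite bstep_kern_final_minus // bstep_kern_final // geo_odd (geo_rec _ t) -/A -/P /B.
have h := qregular_neq0 m hq; have h' := qregular_neq0 n hq.
by field; rewrite h h'.
Qed.

Lemma finite_identity_minus (F : fieldType) (q : F) k j r n : qregular q ->
  (j.+1 + r <= k)%N ->
  bstep q (head_weight q k j.+1 r) (nest q (tail_weight q k j.+1 r) k.-1 2) n =
  qp (- q) q n * \sum_(m < n.+1)
    (target q k j.+1 r m - defect q k j.+1 r m * (q ^+ n / (1 + q ^+ n))) * kern q 0 n m.
Proof.
move=> hq hk.
(* Of the j + 1 variables with - s_i one is s_1, so j remain among the inner sums. *)
have -> : k.-1 = (j + (k - r - j.+1 + r))%N by lia.
have nestE s : nest q (tail_weight q k j.+1 r) (j + (k - r - j.+1 + r)) 2 s = \sum_(m < s.+1)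
    acoef q r m * (q ^+ 'C(m, 2) ^+ 2 * q ^+ m) ^+ (k - r - j.+1) * minus_kern q j s m.
  apply: nest_minus => // i' s' hi; rewrite /tail_weight /tail_exp.
  - by rewrite (_ : i' <= j.+1)%N 1?(_ : (k - r < i')%N = false) ?mul1n ?mul0n ?addn0 //; lia.
  - rewrite (_ : (i' <= j.+1)%N = false) 1?(_ : (k - r < i')%N = false) ?mul0n ?subn0 ?addn0 //; lia.
  - by rewrite (_ : (i' <= j.+1)%N = false) 1?(_ : (k - r < i')%N) ?mul0n ?subn0 ?mul1n //; lia.
rewrite (_ : bstep _ _ _ n = bstep q (fun s => q ^+ 'C(s, 2) * qp (-1) q s)
    (nest q (tail_weight q k j.+1 r) (j + (k - r - j.+1 + r)) 2) n); last first.
  apply: eq_bstep => s _; congr (q ^+ _ * _ * _).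
  by rewrite /head_exp binS bin1 mul1n addnK (_ : (k <= r)%N = false) ?addn0 //; lia.
rewrite (bstep_expand (K := minus_kern q j)
  (a := fun m => acoef q r m * (q ^+ 'C(m, 2) ^+ 2 * q ^+ m) ^+ (k - r - j.+1)) _
  (fun n m => bstep_minus_kern_final j n m hq) nestE); last exact: minus_kern_small.
rewrite mulr_sumr; apply: eq_bigr => m _.
rewrite /target /defect /acoef.
set p := q ^+ 'C(m, 2); set x := q ^+ m; set z := (k - r - j.+1)%N.
have -> : p ^+ (2 * k.+1) = p ^+ (2 * r.+1) * p ^+ 2 ^+ z * p ^+ (2 * j) * p ^+ 2.
  by rewrite -(exprM _ 2) -!exprD; congr (_ ^+ _); rewrite /z; lia.
have -> : x ^+ (k.+1 - r - j.+1) = x * x ^+ z.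
  by rewrite -exprS; congr (_ ^+ _); rewrite /z; lia.
rewrite exprMn -/x.
move: (p ^+ 2 ^+ z) (x ^+ z) (p ^+ (2 * r.+1)) (p ^+ (2 * j)) (x ^+ (2 * r + 1)) => u1 u2 u3 u4 u5.
have h := qregular_neq0 m hq; have h' := qregular_neq0 n hq.
by field; rewrite h h'.
Qed.

Lemma finite_identity_zero (F : fieldType) (q : F) k r n : qregular q ->
  (r < k)%N ->
  bstep q (head_weight q k 0 r) (nest q (tail_weight q k 0 r) k.-1 2) n =
  qp (- q) q n * \sum_(m < n.+1) target q k 0 r m * kern q 0 n m.
Proof.
move=> hq hk.
(* Here s_1 is one of the k - r variables without + s_i. *)
have -> : k.-1 = (k - r.+1 + r)%N by lia.
have nestE s : nest q (tail_weight q k 0 r) (k - r.+1 + r) 2 s = \sum_(m < s.+1)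
    acoef q r m * (q ^+ 'C(m, 2) ^+ 2 * q ^+ m) ^+ (k - r.+1) * kern q 0 s m.
  apply: nest_zero => // i' s' hi; rewrite /tail_weight /tail_exp.
  - by rewrite (_ : (i' <= 0)%N = false) 1?(_ : (k - r < i')%N = false) ?mul0n ?subn0 ?addn0 //; lia.
  - by rewrite (_ : (i' <= 0)%N = false) 1?(_ : (k - r < i')%N) ?mul0n ?subn0 ?mul1n //; lia.
rewrite (_ : bstep _ _ _ n = bstep q (fun s => q ^+ 'C(s.+1, 2) * qp (-1) q s)
    (nest q (tail_weight q k 0 r) (k - r.+1 + r) 2) n); last first.
  apply: eq_bstep => s _; congr (q ^+ _ * _ * _).
  by rewrite /head_exp mul0n subn0 (_ : (k <= r)%N = false) ?addn0 //; lia.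
rewrite (bstep_expand (K := kern q 0)
  (a := fun m => acoef q r m * (q ^+ 'C(m, 2) ^+ 2 * q ^+ m) ^+ (k - r.+1)) _
  (fun n m => bstep_kern_final n m hq) nestE); last exact: kern_small.
rewrite mulr_sumr; apply: eq_bigr => m _.
rewrite /target /acoef muln0 add0n geoS /geo big_ord0 expr0.
set p := q ^+ 'C(m, 2); set x := q ^+ m; set z := (k - r.+1)%N.
have -> : p ^+ (2 * k.+1) = p ^+ (2 * r.+1) * p ^+ 2 ^+ z * p ^+ 2.
  by rewrite -(exprM _ 2) -!exprD; congr (_ ^+ _); rewrite /z; lia.
have -> : x ^+ (k.+1 - r - 0) = x ^+ 2 * x ^+ z.
  by rewrite -exprD; congr (_ ^+ _); rewrite /z; lia.
rewrite exprMn.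
move: (p ^+ 2 ^+ z) (x ^+ z) (p ^+ (2 * r.+1)) (x ^+ (2 * r + 1)) => u1 u2 u3 u5.
have h := qregular_neq0 m hq.
by field; rewrite h.
Qed.

(* When every variable carries [+ s_i], [q^s (-1)_s = (-1)_(s+1) - (-1)_s] splits the
   sum into a [kern q 1] sum and the case [r = k - 1]. *)
Lemma finite_identity_plus (F : fieldType) (q : F) k n : qregular q ->
  bstep q (head_weight q k.+1 0 k.+1) (nest q (tail_weight q k.+1 0 k.+1) k 2) n =
  qp (- q) q n * \sum_(m < n.+1) target q k.+1 0 k.+1 m * kern q 0 n m.
Proof.
move=> hq; set N := nest _ _ _ _.
have hW i' s : (2 <= i' < 2 + k)%N -> tail_weight q k.+1 0 k.+1 i' s = q ^+ (s ^ 2 + 1 * s).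
  move=> hi; rewrite /tail_weight /tail_exp subnn.
  by rewrite (_ : (i' <= 0)%N = false) 1?(_ : (0 < i')%N) ?mul0n ?subn0 ?mul1n //; lia.
have N1 s : N s = \sum_(m < s.+1) (-1) ^+ m *
     (q ^+ 'C(m, 2) * (q ^+ 'C(m, 2) ^+ 2 * q ^+ m ^+ 2) ^+ k.+1) *
     (1 - q ^+ (2 * m + 1)) * kern q 1 s m.
  by rewrite /N (nest_plus _ hq hW); apply: eq_bigr => m _; rewrite mulrA.
have N0 s : N s = \sum_(m < s.+1) acoef q k m * kern q 0 s m.
  by rewrite /N (nest_plus0 _ hq hW).
transitivity (bstep q (fun s => q ^+ 'C(s.+1, 2) * qp (-1) q s.+1) N n
   - bstep q (fun s => q ^+ 'C(s.+1, 2) * qp (-1) q s) N n).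
  rewrite /bstep -sumrB; apply: eq_bigr => s _.
  rewrite /head_weight /head_exp mul0n subn0 leqnn mul1n exprD [qp _ _ s.+1]qpS mulN1r opprK.
  ring.
rewrite (bstep_expand (K := kern q 0) (a := acoef q k) _
  (fun n m => bstep_kern_final n m hq) N0); last exact: kern_small.
rewrite (bstep_expand (K := kern q 1) (a := fun m => (-1) ^+ m *
     (q ^+ 'C(m, 2) * (q ^+ 'C(m, 2) ^+ 2 * q ^+ m ^+ 2) ^+ k.+1) *
     (1 - q ^+ (2 * m + 1))) _
  (fun n m => bstep_kern1_final n m hq) N1); last exact: kern_small.
have -> : \sum_(m < n.+1) (-1) ^+ m *
     (q ^+ 'C(m, 2) * (q ^+ 'C(m, 2) ^+ 2 * q ^+ m ^+ 2) ^+ k.+1) *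
     (1 - q ^+ (2 * m + 1)) * (qp (- q) q n * (2 * q ^+ 'C(m, 2) * q ^+ m) * kern q 1 n m)
  = qp (- q) q n * \sum_(m < n.+1) (-1) ^+ m *
     (2 * q ^+ 'C(m, 2) ^+ 2 * q ^+ m * (q ^+ 'C(m, 2) ^+ 2 * q ^+ m ^+ 2) ^+ k.+1) *
     ((1 - q ^+ (2 * m + 1)) * kern q 1 n m).
  by rewrite mulr_sumr; apply: eq_bigr => m _; ring.
rewrite (kern1_sum
  (c := fun m => 2 * q ^+ 'C(m, 2) ^+ 2 * q ^+ m * (q ^+ 'C(m, 2) ^+ 2 * q ^+ m ^+ 2) ^+ k.+1)
  (c' := fun m => 2 * q ^+ 'C(m, 2) ^+ 2 * q ^+ m * (q ^+ 'C(m, 2) ^+ 2) ^+ k.+1)) //; first last.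
- move=> m; rewrite binS_E (_ : q ^+ (2 * m + 1) = q ^+ m * q ^+ m.+1); last first.
    by rewrite -exprD; congr (_ ^+ _); lia.
  by rewrite !exprMn (exprS q m); ring.
- by rewrite expr0 expr1n !mulr1.
rewrite !mulr_sumr -sumrB; apply: eq_bigr => m _.
rewrite /target /acoef muln0 add0n geoS /geo big_ord0 expr0 -/(sgn_half F m).
set p := q ^+ 'C(m, 2); set x := q ^+ m.
have -> : (k.+2 - k.+1 - 0 = 1)%N by lia.
have -> : p ^+ (2 * k.+2) = p ^+ 2 ^+ k.+1 * p ^+ 2.
  by rewrite -exprM -exprD; congr (_ ^+ _); lia.
rewrite exprMn (exprM p 2 k.+1).
have -> : x ^+ 2 ^+ k.+1 = x ^+ (2 * k + 1) * x by rewrite -exprM -exprSr; congr (_ ^+ _); lia.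
have -> : x ^+ (2 * k.+1 + 1) = x ^+ (2 * k + 1) * x ^+ 2 by rewrite -exprD; congr (_ ^+ _); lia.
move: (p ^+ 2 ^+ k.+1) (x ^+ (2 * k + 1)) => u1 u2.
have h := qregular_neq0 m hq.
by field; rewrite h.
Qed.

Theorem finite_identity (F : fieldType) (q : F) k j r n : qregular q ->
  (0 < k)%N -> (j + r <= k)%N ->
  bstep q (head_weight q k j r) (nest q (tail_weight q k j r) k.-1 2) n =
  qp (- q) q n * \sum_(m < n.+1)
    (target q k j r m - defect q k j r m * (q ^+ n / (1 + q ^+ n))) * kern q 0 n m.
Proof.
move=> hq k0; case: j => [|j] hjr; last exact: finite_identity_minus.
(* For j = 0 the defect contains an empty geometric sum. *)
transitivity (qp (- q) q n * \sum_(m < n.+1) target q k 0 r m * kern q 0 n m); last first.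
  congr (_ * _); apply: eq_bigr => m _.
  by rewrite /defect /geo big_ord0 !(mulr0, mul0r) subr0.
have [lt_rk|le_kr] := ltnP r k; first exact: finite_identity_zero.
have -> : r = k by lia.
by case: k k0 {hjr le_kr} => // k _; apply: finite_identity_plus.
Qed.

(** * Finite triple product *)

Lemma sum_fold (F : fieldType) (q : F) (G : nat -> F) n : qregular q ->
  \sum_(l < (2 * n).+1) G l = \sum_(m < n.+1) half_at0 F m * (G (n + m)%N + G (n - m)%N).
Proof.
move=> hq; rewrite -(big_mkord xpredT) (@big_cat_nat _ _ _ n) //=; last by lia.
have -> : \sum_(n <= i < (2 * n).+1) G i = \sum_(i < n.+1) G (i + n)%N.
  by rewrite -{1}[n]add0n big_addn big_mkord (_ : (2 * n).+1 - n = n.+1)%N //; lia.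
rewrite big_nat_rev /= big_mkord.
rewrite [X in _ + X]big_ord_recl [RHS]big_ord_recl /= add0n addn0 subn0 (half_at0D _ hq).
rewrite addrCA -big_split /=; congr (_ + _); apply: eq_bigr => m _.
by rewrite /bump /= add1n mul1r addrC addnC.
Qed.

(** Homogeneous, so that y = q^n can replace the negative powers of q of a product centred at 0. *)
Lemma q_binomial_hom (F : fieldType) (q x y : F) n :
  \sum_(l < n.+1) gbin q n l * ((-1) ^+ l * q ^+ 'C(l, 2) * x ^+ l * y ^+ (n - l)) =
  \prod_(i < n) (y - x * q ^+ i).
Proof.
elim: n x => [|n IH] x; first by rewrite big_ord_recl !big_ord0 addr0 /= !expr0 !mulr1.
rewrite [RHS]big_ord_recl expr0 mulr1 /=.
rewrite (eq_bigr (fun i : 'I_n => y - (x * q) * q ^+ i)); last first.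
  by move=> i _; rewrite /bump /= add1n exprS mulrA.
rewrite -IH mulrBl big_ord_recl /= subn0.
under eq_bigr => l _ do rewrite /bump /= add1n mulrDl.
rewrite big_split /= addrA addrAC.
have -> : 1 * (1 * q ^+ 'C(0, 2) * 1 * y ^+ n.+1) +
   \sum_(l < n.+1) q ^+ l.+1 * gbin q n l.+1 *
      ((-1) ^+ l.+1 * q ^+ 'C(l.+1, 2) * x ^+ l.+1 * y ^+ (n.+1 - l.+1))
   = \sum_(l < n.+2) q ^+ l * gbin q n l *
      ((-1) ^+ l * q ^+ 'C(l, 2) * x ^+ l * y ^+ (n.+1 - l)).
  by rewrite [RHS]big_ord_recl /= gbin0 !expr0 subn0 !mul1r.
rewrite big_ord_recr /= (@gbin_small _ q n n.+1) // mulr0 mul0r addr0 !mulr_sumr -sumrN.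
congr (_ + _); apply: eq_bigr => l _.
  have -> : (n.+1 - l = (n - l).+1)%N by have := ltn_ord l; lia.
  by rewrite exprMn (exprS y); ring.
by rewrite add0n subSS binS_E exprMn !exprS; ring.
Qed.

Lemma prod_qpow (F : fieldType) (q : F) n : \prod_(i < n) q ^+ i = q ^+ 'C(n, 2).
Proof.
elim: n => [|n IH]; first by rewrite big_ord0.
by rewrite big_ord_recr /= IH binS_E.
Qed.

Lemma bin2B n m : (m <= n)%N ->
  ('C(n - m, 2) + n * (2 * n - (n - m)) = 'C(n, 2) + n * n + 'C(m, 2) + m)%N.
Proof.
move=> le_mn; have [d ->] : exists d, n = (d + m)%N by exists (n - m)%N; lia.
rewrite addnK bin2D; have := mul_bin_diag m 1; rewrite bin1.
by case: m {le_mn} => [|m] /=; nia.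
Qed.

(** The q-binomial theorem of order 2 n for the product of q^n - z q^i: the factors with i >= n give
    (z)_n, and those with i < n give (w)_n because q^n = z w q^(n-1). In the sum, l = n + m and l =
    n - m carry the same binomial coefficient, (q)_(2n) times the kernel. *)
Lemma finite_triple_product (F : fieldType) (q z w : F) n : qregular q -> z * w = q ->
  (q = 0 -> z = 0 /\ w = 0) ->
  qp z q n * qp w q n = \sum_(m < n.+1) sgn_half F m * (q ^+ 'C(m, 2) * (z ^+ m + w ^+ m))
    * (qp q q (2 * n) * kern q 0 n m).
Proof.
(* The common factor taken out below may vanish at q = 0; there only m = 0 contributes. *)
move=> hq zw q0; have [qz|qn0] := eqVneq q 0.
  have [z0 w0] := q0 qz; rewrite z0 w0 qz.
  have e k : qp (0 : F) 0 k = 1.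
    by rewrite /qp big1 // => i _; rewrite mul0r subr0.
  rewrite big_ord_recl big1 => [|m _]; last first.
    by rewrite /= !(exprS 0) !mul0r addr0 !(mulr0, mul0r).
  rewrite /kern /= !e /sgn_half !expr0 !mul1r invr1 !mulr1.
  by have := half_at0D (1 : F) hq => ->; rewrite addr0.
have zn0 : z != 0 by apply: contraNneq qn0 => z0; rewrite -zw z0 mul0r.
have cn0 : (- z) ^+ n * q ^+ ('C(n, 2) + n * n) != 0.
  by rewrite mulf_neq0 // expf_neq0 // oppr_eq0.
apply: (mulfI cn0); have := q_binomial_hom q z (q ^+ n) (2 * n).
have -> : \prod_(i < 2 * n) (q ^+ n - z * q ^+ i) =
    (- z) ^+ n * q ^+ ('C(n, 2) + n * n) * (qp z q n * qp w q n).
  rewrite -(big_mkord xpredT (fun i => q ^+ n - z * q ^+ i)) mul2n -addnn.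
  rewrite (@big_cat_nat _ _ _ n) //=; last by lia.
  have -> : \prod_(n <= i < n + n) (q ^+ n - z * q ^+ i) =
      \prod_(i < n) (q ^+ n - z * q ^+ (i + n)).
    by rewrite -{1}[n]add0n big_addn big_mkord addnK.
  rewrite big_nat_rev /= add0n big_mkord.
  have -> : \prod_(i < n) (q ^+ n - z * q ^+ (n - i.+1)) =
      (- z) ^+ n * q ^+ 'C(n, 2) * qp w q n.
    rewrite -prod_qpow [X in _ = _ * X * _](reindex_inj rev_ord_inj) /= -[X in (- z) ^+ X]card_ord -prodr_const.
    rewrite /qp big_mkord -!big_split /=.
    apply: eq_bigr => i _; have lt_in := ltn_ord i.
    have -> : q ^+ n = z * w * q ^+ i * q ^+ (n - i.+1).
      by rewrite zw -exprS -exprD; congr (_ ^+ _); lia.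
    ring.
  have -> : \prod_(i < n) (q ^+ n - z * q ^+ (i + n)) = q ^+ (n * n) * qp z q n.
    rewrite exprM -[X in _ ^+ n ^+ X]card_ord -prodr_const /qp big_mkord -big_split /=.
    by apply: eq_bigr => i _; rewrite exprD; ring.
  by rewrite exprD; ring.
move=> <-; rewrite (sum_fold (fun l => gbin q (2 * n) l *
  ((-1) ^+ l * q ^+ 'C(l, 2) * z ^+ l * q ^+ n ^+ (2 * n - l))) n hq) mulr_sumr; apply: eq_bigr => m _.
have le_mn : (m <= n)%N by rewrite -ltnS.
have gE l : (l = n + m \/ l = n - m)%N -> gbin q (2 * n) l = qp q q (2 * n) * kern q 0 n m.
  move=> hl; have le_l : (l <= 2 * n)%N by lia.
  rewrite -(gbin_qp q le_l) /kern le_mn addn0.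
  have h1 := qp_neq0 (n - m) hq; have h2 := qp_neq0 (n + m) hq.
  case: hl => hl; rewrite hl.
    have -> : (2 * n - (n + m) = n - m)%N by lia.
    by field; rewrite h1 h2.
  have -> : (2 * n - (n - m) = n + m)%N by lia.
  by field; rewrite h1 h2.
rewrite !gE; [|by right|by left].
have sgn : (-1) ^+ (n - m) = (-1) ^+ n * (-1) ^+ m :> F.
  by rewrite -signr_odd oddB // signr_addb !signr_odd.
have e1 : q ^+ 'C(n + m, 2) * q ^+ n ^+ (2 * n - (n + m)) =
    q ^+ ('C(n, 2) + n * n) * q ^+ 'C(m, 2).
  rewrite -exprM -!exprD bin2D; congr (_ ^+ _).
  have -> : (2 * n - (n + m) = n - m)%N by lia.
  nia.
have e2 : q ^+ 'C(n - m, 2) * z ^+ (n - m) * q ^+ n ^+ (2 * n - (n - m)) =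
    q ^+ ('C(n, 2) + n * n) * q ^+ 'C(m, 2) * (z ^+ n * w ^+ m).
  have -> : z ^+ n * w ^+ m = z ^+ (n - m) * q ^+ m.
    by rewrite -zw exprMn mulrA -exprD subnK.
  transitivity (z ^+ (n - m) * q ^+ ('C(n - m, 2) + n * (2 * n - (n - m)))).
    by rewrite exprD exprM; ring.
  transitivity (z ^+ (n - m) * q ^+ ('C(n, 2) + n * n + 'C(m, 2) + m)); last first.
    by rewrite !exprD; ring.
  by congr (_ * _ ^+ _); apply: bin2B.
have e3 : (- z) ^+ n = (-1) ^+ n * z ^+ n by rewrite -exprMn mulN1r.
transitivity (half_at0 F m * (qp q q (2 * n) * kern q 0 n m) *
   ((-1) ^+ (n + m) * z ^+ (n + m) * (q ^+ 'C(n + m, 2) * q ^+ n ^+ (2 * n - (n + m)))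
   + (-1) ^+ (n - m) * (q ^+ 'C(n - m, 2) * z ^+ (n - m) * q ^+ n ^+ (2 * n - (n - m))))).
  by ring.
rewrite e1 e2 sgn e3 /sgn_half !(exprD _ n m); ring.
Qed.

Local Open Scope classical_set_scope.
Local Open Scope ring_scope.
Local Open Scope complex_scope.

(** * Limits of complex sequences *)

(* The modulus as an element of [R]; [`|z|] lies in [R[i]]. *)
Local Notation nm := (@Normc.normc _).

Lemma normC_nm (R : realType) (z : R[i]) : `|z| = (nm z)%:C. Proof. by []. Qed.

Lemma nm_ge0 (R : realType) (z : R[i]) : 0 <= nm z.
Proof. by rewrite -lecR -normC_nm normr_ge0. Qed.

Lemma nmX (R : realType) (z : R[i]) n : nm (z ^+ n) = nm z ^+ n.
Proof.
by elim: n => [|n IH]; rewrite ?expr0 ?Normc.normc1 // !exprS Normc.normcM IH.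
Qed.

Lemma nm_sum (R : realType) (I : Type) (s : seq I) (P : pred I) (f : I -> R[i]) :
  nm (\sum_(i <- s | P i) f i) <= \sum_(i <- s | P i) nm (f i).
Proof.
elim/big_ind2: _ => [|x x' y y' hx hy|//]; first by rewrite Normc.normc0.
by apply: le_trans (le_normcD _ _) _; apply: lerD.
Qed.

Lemma nm_prod (R : realType) (I : Type) (s : seq I) (P : pred I) (f : I -> R[i]) :
  nm (\prod_(i <- s | P i) f i) = \prod_(i <- s | P i) nm (f i).
Proof. by apply: (big_morph nm); [exact: Normc.normcM | exact: Normc.normc1]. Qed.

Lemma cvg_nmP (R : realType) (T : Type) (G : set_system T) {FG : Filter G}
    (u : T -> R[i]) (l : R[i]) :
  ((u : T -> R[i]^o) @ G --> (l : R[i]^o)) <->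
  (forall e : R, 0 < e -> \forall n \near G, nm (l - u n) < e).
Proof.
split=> [/cvgrPdist_lt H e e0|H].
  by near=> n; rewrite -ltcR -normC_nm; near: n; apply: H; rewrite ltcR.
apply/cvgrPdist_lt => e e0.
have er : e = (complex.Re e)%:C by rewrite RRe_real // gtr0_real.
have e0' : 0 < complex.Re e by rewrite -ltcR -er.
by near=> n; rewrite normC_nm er ltcR; near: n; apply: H.
Unshelve. all: by end_near. Qed.

Lemma cvg_nm0 (R : realType) (u : nat -> R[i]) (l : R[i]) :
  ((fun n => nm (l - u n)) @ \oo --> (0 : R)) -> (u : nat -> R[i]^o) @ \oo --> (l : R[i]^o).
Proof.
move=> /cvgrPdist_lt H; apply/cvg_nmP => e e0.
near=> n; have : `|0 - nm (l - u n)| < e by near: n; apply: H.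
by rewrite sub0r normrN ger0_norm ?nm_ge0.
Unshelve. all: by end_near. Qed.

Lemma cvg_increments (R : realType) (u : nat -> R) (K s : R) : 0 <= s < 1 ->
  (forall n, `|u n.+1 - u n| <= K * s ^+ n) -> cvgn u.
Proof.
move=> /andP[s0 s1] hu.
have H : cvgn (series (fun n => u n.+1 - u n)).
  apply: normed_cvg; apply: (@series_le_cvg _ _ (geometric K s)) => //.
  - by move=> n; apply: normr_ge0.
  - by move=> n; apply: le_trans (normr_ge0 _) (hu n).
  - by apply: is_cvg_geometric_series; rewrite ger0_norm.
have -> : u = (fun n => u 0%N + series (fun n => u n.+1 - u n) n).
  apply/funext => n; rewrite /series /= telescope_sumr //; ring.
by apply: is_cvgD => //; apply: is_cvg_cst.
Qed.

Lemma nm_ReIm (R : realType) (z : R[i]) :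
  [/\ `|complex.Re z| <= nm z, `|complex.Im z| <= nm z &
      nm z <= `|complex.Re z| + `|complex.Im z|].
Proof.
have hRe (w : R[i]) : `|complex.Re w| <= nm w by rewrite -lecR normc_ge_Re.
case: z => a b; split; first exact: hRe.
- have := hRe ('i%C * (a +i* b)); rewrite Normc.normcM.
  have -> : nm 'i%C = 1 :> R by rewrite /= expr0n expr1n add0r sqrtr1.
  by rewrite mul1r /= mul0r mul1r sub0r normrN.
- rewrite [X in nm X](complexE (a +i* b)); apply: le_trans (le_normcD _ _) _; rewrite Normc.normcM /=.
  by rewrite !expr0n expr1n add0r sqrtr1 mul1r !addr0 !sqrtr_sqr.
Qed.

Lemma cvgC_increments (R : realType) (u : nat -> R[i]) (K s : R) : 0 <= s < 1 ->
  (forall n, nm (u n.+1 - u n) <= K * s ^+ n) ->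
  exists l : R[i], (u : nat -> R[i]^o) @ \oo --> (l : R[i]^o).
Proof.
move=> hs hu.
have /(cvg_increments hs)/cvg_ex[/= a ha] :
    forall n, `|complex.Re (u n.+1) - complex.Re (u n)| <= K * s ^+ n.
  by move=> n; rewrite -raddfB; apply: le_trans (hu n); case: (nm_ReIm (u n.+1 - u n)).
have /(cvg_increments hs)/cvg_ex[/= b hb] :
    forall n, `|complex.Im (u n.+1) - complex.Im (u n)| <= K * s ^+ n.
  by move=> n; rewrite -raddfB; apply: le_trans (hu n); case: (nm_ReIm (u n.+1 - u n)).
exists (a +i* b)%C; apply: cvg_nm0.
apply: (@squeeze_cvgr _ _ _ _ (fun=> 0) (fun n => `|a - complex.Re (u n)| + `|b - complex.Im (u n)|)).
- near=> n; rewrite nm_ge0 /=.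
  by case: (nm_ReIm ((a +i* b)%C - u n)) => _ _; rewrite !raddfB.
- exact: cvg_cst.
- rewrite -[X in _ --> X]addr0; apply: cvgD.
    by rewrite -(normr0 R) -(subrr a); apply: cvg_norm; apply: cvgB => //; apply: cvg_cst.
  by rewrite -(normr0 R) -(subrr b); apply: cvg_norm; apply: cvgB => //; apply: cvg_cst.
Unshelve. all: by end_near. Qed.

Lemma geo_tail_le (R : realType) (s : R) m n : 0 <= s < 1 ->
  \sum_(m <= i < n) s ^+ i <= s ^+ m / (1 - s).
Proof.
move=> /andP[s0 s1]; have h : 0 < 1 - s by rewrite subr_gt0.
have [le_mn|lt_nm] := leqP m n; last first.
  by rewrite big_geq 1?ltnW // divr_ge0 ?exprn_ge0 // ltW.
rewrite ler_pdivlMr //.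
have -> : (\sum_(m <= i < n) s ^+ i) * (1 - s) = s ^+ m - s ^+ n.
  rewrite mulr_suml -[RHS]opprB -(telescope_sumr _ le_mn) -sumrN.
  by apply: eq_bigr => i _; rewrite exprS; ring.
by rewrite gerBl exprn_ge0.
Qed.

Lemma cvgC_cst (R : realType) (l : R[i]) : ((fun=> l) : nat -> R[i]^o) @ \oo --> (l : R[i]^o).
Proof. exact: cvg_cst. Qed.

Lemma cvgCM (R : realType) (u v : nat -> R[i]) (l m : R[i]) :
  (u : nat -> R[i]^o) @ \oo --> (l : R[i]^o) -> (v : nat -> R[i]^o) @ \oo --> (m : R[i]^o) ->
  ((fun n => u n * v n) : nat -> R[i]^o) @ \oo --> (l * m : R[i]^o).
Proof. by move=> hu hv; apply: cvgM; [exact: hu | exact: hv]. Qed.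

Lemma cvgCD (R : realType) (u v : nat -> R[i]) (l m : R[i]) :
  (u : nat -> R[i]^o) @ \oo --> (l : R[i]^o) -> (v : nat -> R[i]^o) @ \oo --> (m : R[i]^o) ->
  ((fun n => u n + v n) : nat -> R[i]^o) @ \oo --> (l + m : R[i]^o).
Proof. by move=> hu hv; apply: cvgD; [exact: hu | exact: hv]. Qed.

Lemma cvgCB (R : realType) (u v : nat -> R[i]) (l m : R[i]) :
  (u : nat -> R[i]^o) @ \oo --> (l : R[i]^o) -> (v : nat -> R[i]^o) @ \oo --> (m : R[i]^o) ->
  ((fun n => u n - v n) : nat -> R[i]^o) @ \oo --> (l - m : R[i]^o).
Proof. by move=> hu hv; apply: cvgB; [exact: hu | exact: hv]. Qed.

Lemma cvgC_sum (R : realType) (T I : Type) (G : set_system T) {FG : Filter G}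
    (r : seq I) (f : I -> T -> R[i]) (l : I -> R[i]) :
  (forall i, (f i : T -> R[i]^o) @ G --> (l i : R[i]^o)) ->
  ((fun x => \sum_(i <- r) f i x) : T -> R[i]^o) @ G --> (\sum_(i <- r) l i : R[i]^o).
Proof.
move=> hf; elim: r => [|i r IH].
  by under eq_fun do rewrite big_nil; rewrite big_nil; apply: cvg_cst.
under eq_fun do rewrite big_cons; rewrite big_cons; apply: cvgD; [exact: hf | exact: IH].
Qed.

(** Dominated convergence for triangular sums, with a geometric majorant. The limit 0 suffices,
    since it is applied to differences between summands and their limits. *)
Lemma tannery0 (R : realType) (d : nat -> nat -> R[i]) (K s : R) : 0 <= s < 1 ->
  (forall n m, (m <= n)%N -> nm (d n m) <= K * s ^+ m) ->
  (forall m, (d ^~ m : nat -> R[i]^o) @ \oo --> (0 : R[i]^o)) ->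
  ((fun n => \sum_(m < n.+1) d n m) : nat -> R[i]^o) @ \oo --> (0 : R[i]^o).
Proof.
move=> hs hd d0; have /andP[s0 s1] := hs.
have h1 : 0 < 1 - s by rewrite subr_gt0.
have K0 : 0 <= K.
  by have := hd 0%N 0%N isT; rewrite expr0 mulr1; apply: le_trans; apply: nm_ge0.
apply/cvg_nmP => e e0.
have [M hM] : exists M, K * (s ^+ M / (1 - s)) < e / 2.
  have : (fun n => K / (1 - s) * s ^+ n) @ \oo --> (0 : R).
    by apply: cvg_geometric; rewrite ger0_norm.
  move=> /cvgrPdist_lt /(_ (e / 2)) []; first by rewrite divr_gt0.
  move=> M _ /(_ M (leqnn M)) /=; rewrite sub0r normrN ger0_norm => [H|].
    by exists M; move: H; rewrite mulrAC mulrA.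
  by rewrite mulr_ge0 ?exprn_ge0 // divr_ge0 // ltW.
have : ((fun n => \sum_(m < M) d n m) : nat -> R[i]^o) @ \oo --> (0 : R[i]^o).
  have := @cvgC_sum R nat 'I_M \oo _ (index_enum 'I_M) (fun m n => d n m) (fun=> 0) (fun m => d0 m).
  by rewrite big1_eq => H; exact: H.
move=> /cvg_nmP /(_ (e / 2)) H; near=> n.
have le_Mn : (M <= n.+1)%N by rewrite leqW //; near: n; exists M.
have hM' : nm (0 - \sum_(m < M) d n m) < e / 2.
  by near: n; apply: H; rewrite divr_gt0.
rewrite -(big_mkord xpredT (d n)) (@big_cat_nat _ _ _ M) //= big_mkord opprD addrA.
apply: le_lt_trans (le_normcD _ _) _; rewrite [e]splitr; apply: ltrD => //.
rewrite normcN; apply: le_lt_trans hM.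
apply: le_trans (nm_sum _ _ _) _.
apply: (@le_trans _ _ (K * \sum_(M <= i < n.+1) s ^+ i)).
  rewrite mulr_sumr [leLHS]big_nat [leRHS]big_nat; apply: ler_sum => i /andP[_ hi].
  exact: hd.
by rewrite ler_wpM2l // geo_tail_le.
Unshelve. all: by end_near. Qed.

(** * Sums over nonincreasing sequences *)

Fixpoint decseqs (d n : nat) : seq (seq nat) :=
  if d is d'.+1 then [seq s :: l | s <- iota 0 n.+1, l <- decseqs d' s] else [:: [::]].

Lemma mem_decseqs d n l : (l \in decseqs d n) = (size l == d) && path geq n l.
Proof.
elim: d n l => [|d IH] n l; first by case: l.
apply/idP/andP => [/allpairsPdep[s [t [hs ht ->]]]|].
  move: hs ht; rewrite mem_iota IH /= => hs /andP[/eqP-> ht].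
  by rewrite eqxx ht andbT.
case: l => [[]//|s t] [ht]; rewrite [path _ _ _]/= => /andP[hs hp].
by apply/allpairsPdep; exists s, t; rewrite mem_iota IH -eqSS ht hp.
Qed.

Lemma decseqs_uniq d n : uniq (decseqs d n).
Proof.
elim: d n => [//|d IH] n; apply: allpairs_uniq_dep => [|s _|]; [exact: iota_uniq | exact: IH |].
by move=> [s t] [s' t'] _ _ [-> ->].
Qed.

Lemma sum_decseqsS (V : zmodType) (g : seq nat -> V) d n :
  \sum_(l <- decseqs d.+1 n) g l = \sum_(s < n.+1) \sum_(l <- decseqs d s) g (nat_of_ord s :: l).
Proof.
by rewrite /decseqs -/decseqs big_allpairs_dep -(big_mkord xpredT (fun s => \sum_(l <- decseqs d s) g (s :: l))) /index_iota subn0.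
Qed.

Fixpoint chain_term (F : fieldType) (q : F) (W : nat -> nat -> F) (i n : nat) (l : seq nat) : F :=
  if l is s :: l' then W i s / qp q q (n - s) * chain_term q W i.+1 s l' else (qp q q n)^-1.

Lemma sum_chain_term (F : fieldType) (q : F) (W : nat -> nat -> F) d i n :
  \sum_(l <- decseqs d n) chain_term q W i n l = nest q W d i n.
Proof.
elim: d i n => [|d IH] i n; first by rewrite big_seq1.
rewrite sum_decseqsS /=; apply: eq_bigr => s _.
by rewrite -IH mulr_sumr.
Qed.

Lemma ler_sum_subseq (R : realType) (T : eqType) (f : T -> R) (s1 s2 : seq T) :
  (forall x, 0 <= f x) -> uniq s1 -> {subset s1 <= s2} ->
  \sum_(x <- s1) f x <= \sum_(x <- s2) f x.
Proof.
move=> f0; elim: s1 s2 => [|x s1 IH] s2 => [_ _|/= /andP[xs1 us1] sub].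
  by rewrite big_nil sumr_ge0.
have xs2 : x \in s2 by apply: sub; rewrite mem_head.
rewrite big_cons (big_rem x xs2) /=.
rewrite lerD2l; apply: IH => // y ys1.
have yx : y != x by apply: contraNneq xs1 => <-.
by have := sub y; rewrite inE ys1 orbT => /(_ isT) /(rem_mem yx).
Qed.

Definition to_noninc (k : nat) (l : seq nat) : option (noninc k) :=
  obind (fun t : k.-tuple nat => insub t) (insub l).

Lemma to_nonincK k (s : noninc k) : to_noninc k (val (val s)) = Some s.
Proof. by rewrite /to_noninc valK /= valK. Qed.

Lemma val_noninc_inj k : injective (fun s : noninc k => val (val s)).
Proof. by move=> s s' /val_inj /val_inj. Qed.

Lemma noninc_mem k (s : noninc k.+1) M : (head 0%N (val (val s)) <= M)%N ->
  val (val s) \in decseqs k.+1 M.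
Proof.
rewrite mem_decseqs; case: s => [[l hl] hs] /=; rewrite hl /=.
by move: hs => /=; case: l hl => //= x l _ -> ->.
Qed.

(** Terms are grouped by their largest entry n. In a finite set containing all sequences with
    entries at most N, these contribute exactly a partial sum of f, and the others are bounded by a
    geometric tail. *)
Lemma has_sum_noninc (R : realType) (k : nat) (g : seq nat -> R[i]) (f : nat -> R[i])
    (l : R[i]) (K s : R) : 0 <= s < 1 ->
  (forall n, \sum_(t <- decseqs k n) g (n :: t) = f n) ->
  (forall n, \sum_(t <- decseqs k n) nm (g (n :: t)) <= K * s ^+ n) ->
  ((fun n => \sum_(m < n.+1) f m) : nat -> R[i]^o) @ \oo --> (l : R[i]^o) ->
  has_sum (fun t : noninc k.+1 => g (val (val t))) l.
Proof.
move=> hs hf hK hl; have /andP[s0 s1] := hs.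
have h1 : 0 < 1 - s by rewrite subr_gt0.
have K0 : 0 <= K.
  have := hK 0%N; rewrite expr0 mulr1; apply: le_trans.
  by rewrite sumr_ge0 // => t _; apply: nm_ge0.
have FG : Filter (@summability.totally (noninc k.+1)) by apply: filter_filter; apply: summability.totally_filter.
apply/cvg_nmP => e e0.
have [N hN1 hN2] : exists2 N, nm (l - \sum_(m < N.+1) f m) < e / 2 & K * (s ^+ N.+1 / (1 - s)) < e / 2.
  have c2 : (fun n => K / (1 - s) * s ^+ n) @ \oo --> (0 : R).
    by apply: cvg_geometric; rewrite ger0_norm.
  have e2 : 0 < e / 2 by rewrite divr_gt0.
  move/cvg_nmP: hl => /(_ _ e2) [N1 _ H1].
  move/cvgrPdist_lt: c2 => /(_ _ e2) [N2 _ H2].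
  exists (maxn N1 N2); first by apply: H1; rewrite /= leq_maxl.
  have := H2 (maxn N1 N2).+1; rewrite /= leqW ?leq_maxr // => /(_ isT).
  rewrite sub0r normrN ger0_norm; first by rewrite mulrAC mulrA.
  by rewrite mulr_ge0 ?exprn_ge0 // divr_ge0 // ltW.
have [D eD] : exists D, D = decseqs k.+1 N by exists (decseqs k.+1 N).
pose A0 : {fset noninc k.+1} := [fset x in pmap (@to_noninc k.+1) D]%fset.
exists A0 => // B /= /fsubsetP sAB.
pose LB := [seq val (val t) | t : noninc k.+1 <- enum_fset B].
have uLB : uniq LB by rewrite map_inj_uniq ?fset_uniq //; apply: val_noninc_inj.
have -> : summability.partial_sum (fun t : noninc k.+1 => g (val (val t)) : R[i]^o) B = \sum_(t <- LB) g t.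
  by rewrite /summability.partial_sum big_map big_seq_fsetE.
have -> : \sum_(t <- LB) g t =
    \sum_(t <- [seq t <- LB | t \in D]) g t + \sum_(t <- [seq t <- LB | t \notin D]) g t.
  by rewrite !big_filter (bigID [in D]).
have -> : \sum_(t <- [seq t <- LB | t \in D]) g t = \sum_(m < N.+1) f m.
  transitivity (\sum_(t <- D) g t).
    apply: perm_big; apply: uniq_perm; rewrite ?filter_uniq // ?eD ?decseqs_uniq // -eD => t.
    rewrite mem_filter; case: (boolP (t \in D)) => //= tD.
    move: (tD); rewrite eD mem_decseqs => /andP[ht pt].
    have srt : sorted geq (Tuple ht) by move: pt => /=; case: (t) => //= x l' /andP[].
    pose u : noninc k.+1 := exist _ (Tuple ht) srt.
    apply/mapP; exists u => //; apply: sAB; rewrite inE /= mem_pmap; apply/mapP.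
    by exists t; [|apply: esym; exact: (to_nonincK u)].
  by rewrite eD sum_decseqsS; apply: eq_bigr => m _; rewrite hf.
set LT := [seq t <- LB | t \notin D].
rewrite opprD addrA; apply: le_lt_trans (le_normcD _ _) _; rewrite [e]splitr; apply: ltrD => //.
rewrite normcN; apply: le_lt_trans hN2; apply: le_trans (nm_sum _ _ _) _.
(* M bounds the entries occurring in B, so that what lies outside D is part of the finite list E. *)
pose M := \max_(t <- LB) head 0%N t.
pose E := [seq n :: t | n <- index_iota N.+1 M.+1, t <- decseqs k n].
apply: (@le_trans _ _ (\sum_(t <- E) nm (g t))).
  apply: ler_sum_subseq; [by move=> t; apply: nm_ge0 | by rewrite filter_uniq |].
  move=> t; rewrite mem_filter => /andP[tD tB].
  have hM : (head 0%N t <= M)%N by rewrite /M; apply: (@leq_bigmax_seq _ LB xpredT (head 0%N)).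
  have tM : t \in decseqs k.+1 M.
    by move: tB hM => /mapP[u _ ->]; apply: noninc_mem.
  move: tM tD hM; rewrite eD !mem_decseqs; case: t {tB} => // n t /=; rewrite eqSS.
  move=> /andP[ht /andP[_ pt]]; rewrite ht pt !andbT /= -ltnNge => ltN leM.
  apply/allpairsPdep; exists n, t; rewrite mem_index_iota ltN ltnS leM mem_decseqs ht pt.
  by split.
rewrite big_allpairs_dep /=.
apply: (@le_trans _ _ (K * \sum_(N.+1 <= i < M.+1) s ^+ i)).
  by rewrite mulr_sumr; apply: ler_sum => i _; apply: hK.
by rewrite ler_wpM2l // geo_tail_le.
Qed.

(** * Jacobi's triple product *)

Lemma nm_lt1 (R : realType) (q : R[i]) : `|q| < 1 -> nm q < 1.
Proof. by rewrite normC_nm -[1 in X in X -> _]/(1%:C) ltcR. Qed.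

Lemma nm_qregular (R : realType) (q : R[i]) : nm q < 1 -> qregular q.
Proof.
move=> q1; have h n : nm (q ^+ n.+1) < 1 by rewrite nmX exprn_ilt1 // nm_ge0.
split=> [n|[|n]].
- by apply: contraTneq (h n) => ->; rewrite Normc.normc1 ltxx.
- by rewrite expr0 -subr_eq0 opprK -mulr2n pnatr_eq0.
- by apply: contraTneq (h n) => ->; rewrite normcN Normc.normc1 ltxx.
Qed.

Lemma geo_sum_le (R : realType) (s : R) n : 0 <= s < 1 ->
  \sum_(0 <= i < n) s ^+ i <= (1 - s)^-1.
Proof. by move=> hs; apply: le_trans (geo_tail_le 0 n hs) _; rewrite expr0 mul1r. Qed.

Lemma expR_sum (R : realType) (I : Type) (r : seq I) (f : I -> R) :
  expR (\sum_(i <- r) f i) = \prod_(i <- r) expR (f i).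
Proof. by apply: (big_morph expR); [exact: expRD | exact: expR0]. Qed.

Lemma nm_qp_le (R : realType) (x q : R[i]) : nm q < 1 ->
  exists2 B : R, 0 < B & forall n, nm (qp x q n) <= B.
Proof.
move=> q1; have hs : 0 <= nm q < 1 by rewrite nm_ge0.
exists (expR (nm x / (1 - nm q))) => [|n]; first exact: expR_gt0.
rewrite /qp nm_prod.
apply: (@le_trans _ _ (expR (\sum_(0 <= i < n) nm x * nm q ^+ i))).
  rewrite expR_sum; apply: ler_prod => i _; rewrite nm_ge0 /=.
  apply: le_trans (le_normcD _ _) _; rewrite normcN Normc.normc1 Normc.normcM nmX.
  exact: expR_ge1Dx.
by rewrite ler_expR -mulr_sumr ler_wpM2l ?nm_ge0 // geo_sum_le.
Qed.

(** For 0 <= t <= s one has 1 - t >= exp (- t / (1 - s)), because (1 + t / (1 - s)) (1 - t) >= 1;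
    the sum of the s^(i+1), at most 1 / (1 - s), gives the constant. *)
Lemma nm_qp_ge (R : realType) (q : R[i]) : nm q < 1 ->
  exists2 c : R, 0 < c & forall n, c <= nm (qp q q n).
Proof.
move=> q1; set s := nm q; have s0 : 0 <= s := nm_ge0 q.
have hs : 0 <= s < 1 by rewrite s0.
have h1 : 0 < 1 - s by rewrite subr_gt0.
exists (expR (- ((1 - s)^-1 / (1 - s)))) => [|n]; first exact: expR_gt0.
apply: (@le_trans _ _ (expR (\sum_(0 <= i < n) - (s ^+ i.+1 / (1 - s))))).
  rewrite ler_expR sumrN lerN2 -mulr_suml ler_wpM2r ?invr_ge0 ?(ltW h1) //.
  apply: le_trans (geo_sum_le n hs); apply: ler_sum => i _.
  by rewrite exprS ler_piMl ?exprn_ge0 // ltW.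
rewrite expR_sum /qp nm_prod; apply: ler_prod => i _; rewrite expR_ge0 /=.
set t := s ^+ i.+1.
have t0 : 0 <= t by rewrite exprn_ge0.
have ts : t <= s by rewrite /t exprS ler_piMr // exprn_ile1 // ltW.
have low : 1 - t <= nm (1 - q * q ^+ i).
  have := le_normcD (1 - q * q ^+ i) (q * q ^+ i); rewrite subrK Normc.normc1.
  by rewrite -[in X in _ <= _ + X]exprS nmX -/s -/t lerBlDr.
apply: le_trans low; rewrite expRN invf_ple ?posrE ?expR_gt0 //; last first.
  by rewrite subr_gt0 (le_lt_trans ts).
apply: le_trans (expR_ge1Dx _).
rewrite -div1r ler_pdivrMr ?subr_gt0 ?(le_lt_trans ts) //.
have -> : (1 + t / (1 - s)) * (1 - t) = 1 + t * (s - t) / (1 - s).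
  by field; rewrite gt_eqF.
by rewrite lerDl divr_ge0 ?mulr_ge0 ?subr_ge0 // ltW.
Qed.

(** As [qpoch_inf] is a [lim], some limit has to be exhibited: up to sign, consecutive partial
    products differ by x q^n (x)_n, and (x)_n is bounded. *)
Lemma qp_cvg (R : realType) (x q : R[i]) : nm q < 1 ->
  (qp x q : nat -> R[i]^o) @ \oo --> (qpoch_inf x q : R[i]^o).
Proof.
move=> q1; have [B B0 hB] := nm_qp_le x q1.
have hs : 0 <= nm q < 1 by rewrite nm_ge0.
have [l hl] : exists l : R[i], (qp x q : nat -> R[i]^o) @ \oo --> (l : R[i]^o).
  apply: (@cvgC_increments _ _ (B * nm x) _ hs) => n.
  rewrite qpS (_ : _ - _ = - (qp x q n * (x * q ^+ n))); last by ring.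
  rewrite normcN !Normc.normcM nmX mulrA ler_wpM2r ?exprn_ge0 ?nm_ge0 //.
  by rewrite ler_wpM2r ?nm_ge0.
by apply: cvgP hl.
Qed.

Lemma qpoch_inf_neq0 (R : realType) (q : R[i]) : nm q < 1 -> qpoch_inf q q != 0.
Proof.
move=> q1; have [c c0 hc] := nm_qp_ge q1; apply/eqP => h0.
have /cvg_nmP /(_ c c0) [N _ /(_ N (leqnn N))] := @qp_cvg R q q q1.
by rewrite /= h0 sub0r normcN ltNge hc.
Qed.

Lemma cvg_reindex (R : realType) (u : nat -> R[i]) (l : R[i]) (h : nat -> nat) :
  (forall M, exists N, forall n, (N <= n)%N -> (M <= h n)%N) ->
  (u : nat -> R[i]^o) @ \oo --> (l : R[i]^o) ->
  ((fun n => u (h n)) : nat -> R[i]^o) @ \oo --> (l : R[i]^o).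
Proof.
move=> hh /cvg_nmP hu; apply/cvg_nmP => e /hu [M _ HM].
by have [N HN] := hh M; exists N => // n /HN; apply: HM.
Qed.

Lemma cvg_qp_inv (R : realType) (q : R[i]) (h : nat -> nat) : nm q < 1 ->
  (forall M, exists N, forall n, (N <= n)%N -> (M <= h n)%N) ->
  ((fun n => (qp q q (h n))^-1) : nat -> R[i]^o) @ \oo --> ((qpoch_inf q q)^-1 : R[i]^o).
Proof.
move=> q1 hh; apply: cvgV; first exact: qpoch_inf_neq0.
exact: cvg_reindex (@qp_cvg R q q q1).
Qed.

Lemma cvg_kern (R : realType) (q : R[i]) m : nm q < 1 ->
  ((fun n => kern q 0 n m) : nat -> R[i]^o) @ \oo --> ((qpoch_inf q q)^-2 : R[i]^o).
Proof.
move=> q1.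
have c : ((fun n => (qp q q (n - m))^-1 * (qp q q (n + m + 0))^-1) : nat -> R[i]^o) @ \oo
    --> ((qpoch_inf q q)^-1 * (qpoch_inf q q)^-1 : R[i]^o).
  by apply: cvgM; apply: cvg_qp_inv => // M; exists (M + m)%N => n; lia.
rewrite -expr2 exprVn in c.
apply/cvg_nmP => e e0; move/cvg_nmP: c => /(_ e e0) [N _ H].
exists (maxn N m) => // n; rewrite /= geq_max => /andP[hN hm].
by rewrite /kern hm (invfM (qp q q (n - m))); apply: H.
Qed.

Lemma nm2 (R : realType) : nm (2 : R[i]) = 2.
Proof.
have -> : (2 : R[i]) = (2 : R)%:C by rewrite rmorph_nat.
by rewrite /= expr0n addr0 sqrtr_sqr ger0_norm.
Qed.

Lemma nm_half (R : realType) m : nm (sgn_half R[i] m) <= 1.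
Proof.
have -> : nm (sgn_half R[i] m) = nm (half_at0 R[i] m).
  by rewrite /sgn_half Normc.normcM nmX normcN Normc.normc1 expr1n mulr1.
case: m => [|m]; rewrite /half_at0; last by rewrite Normc.normc1.
by rewrite Normc.normcV nm2 invf_le1 // ler1n.
Qed.

Lemma nm_kern_le (R : realType) (q : R[i]) : nm q < 1 ->
  exists2 D : R, 0 < D & forall n m, nm (kern q 0 n m) <= D.
Proof.
move=> q1; have [c c0 hc] := nm_qp_ge q1.
exists (c^-1 * c^-1) => [|n m]; first by rewrite mulr_gt0 ?invr_gt0.
rewrite /kern; case: ifP => _; last by rewrite Normc.normc0 mulr_ge0 ?invr_ge0 // ltW.
rewrite invfM Normc.normcM !Normc.normcV ler_pM ?invr_ge0 ?nm_ge0 //;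
  by rewrite lef_pV2 ?posrE // (lt_le_trans c0).
Qed.

(** The terms m and - m of the series of (-1)^m q^'C(m, 2) z^m: for z w = q != 0, the term - m has
    w^m in place of z^m. *)
Definition theta_coef (F : fieldType) (q z w : F) (m : nat) : F :=
  sgn_half F m * (q ^+ 'C(m, 2) * (z ^+ m + w ^+ m)).

Lemma nm_theta_le (R : realType) (q z w : R[i]) (s : R) m : nm q <= 1 -> nm z <= s -> nm w <= s ->
  nm (theta_coef q z w m) <= 2 * s ^+ m.
Proof.
move=> q1 zs ws; have s0 : 0 <= s := le_trans (nm_ge0 z) zs.
have le1 : nm (z ^+ m + w ^+ m) <= 2 * s ^+ m.
  apply: le_trans (le_normcD _ _) _; rewrite !nmX mulrDl mul1r.
  by rewrite lerD // lerXn2r ?nnegrE ?nm_ge0.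
have le2 : nm (q ^+ 'C(m, 2)) <= 1 by rewrite nmX exprn_ile1 ?nm_ge0.
have le3 : nm (q ^+ 'C(m, 2) * (z ^+ m + w ^+ m)) <= 2 * s ^+ m.
  by rewrite Normc.normcM -[leRHS]mul1r; apply: ler_pM; rewrite ?nm_ge0.
rewrite /theta_coef Normc.normcM -[leRHS]mul1r.
by apply: ler_pM; rewrite ?nm_ge0 ?nm_half.
Qed.

Lemma jacobi_triple_product (R : realType) (q z w : R[i]) (s : R) : nm q < 1 ->
  nm z <= s -> nm w <= s -> s < 1 -> z * w = q -> (q = 0 -> z = 0 /\ w = 0) ->
  ((fun n => \sum_(m < n.+1) theta_coef q z w m) : nat -> R[i]^o) @ \oo
    --> (qpochs_inf [:: q; z; w] q : R[i]^o).
Proof.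
move=> q1 zs ws s1 zw q0; have hq := nm_qregular q1.
have s0 : 0 <= s := le_trans (nm_ge0 z) zs.
have hs : 0 <= s < 1 by rewrite s0.
have cn0 := qpoch_inf_neq0 q1; set c := qpoch_inf q q in cn0 *.
have [D D0 hD] := nm_kern_le q1; have [B B0 hB] := @nm_qp_le R q q q1.
have coefle m : nm (theta_coef q z w m) <= 2 * s ^+ m by apply: nm_theta_le => //; apply: ltW.
(* In the finite product, (q)_(2n) times the kernel tends to 1 / (q)_oo; [d] measures the
   deviation. *)
pose d n m := theta_coef q z w m * (qp q q (2 * n) * kern q 0 n m - c^-1).
have d0 : ((fun n => \sum_(m < n.+1) d n m) : nat -> R[i]^o) @ \oo --> (0 : R[i]^o).
  apply: (@tannery0 _ _ (2 * (B * D + nm c^-1)) s hs) => [n m _|m].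
    rewrite /d Normc.normcM mulrAC; apply: ler_pM; rewrite ?nm_ge0 ?coefle //.
    apply: le_trans (le_normcD _ _) _; rewrite normcN lerD2r Normc.normcM.
    by apply: ler_pM; rewrite ?nm_ge0.
  rewrite -[X in _ --> X](mulr0 (theta_coef q z w m)); apply: cvgM; first exact: cvg_cst.
  rewrite -[X in _ --> X](subrr c^-1); apply: cvgB; last exact: cvg_cst.
  have -> : c^-1 = c * c^-2 :> R[i]^o by rewrite expr2 invfM mulrA divff // mul1r.
  apply: cvgM; last exact: cvg_kern.
  by apply: cvg_reindex (@qp_cvg R q q q1) => M; exists M => n; lia.
have E n : \sum_(m < n.+1) theta_coef q z w m = c * (qp z q n * qp w q n - \sum_(m < n.+1) d n m).
  rewrite (finite_triple_product n hq zw q0) -sumrB mulr_sumr.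
  by apply: eq_bigr => m _; rewrite /d /theta_coef; field.
have -> : qpochs_inf [:: q; z; w] q = c * (qpoch_inf z q * qpoch_inf w q - 0).
  by rewrite /qpochs_inf !big_cons big_nil subr0 mulr1.
rewrite (eq_fun E).
exact: (cvgCM (@cvgC_cst R c) (cvgCB (cvgCM (@qp_cvg R z q q1) (@qp_cvg R w q q1)) d0)).
Qed.

(** * The limit of the finite identity *)

Lemma geo_mul (F : fieldType) (y : F) n : (1 - y) * geo y n = 1 - y ^+ n.
Proof.
elim: n => [|n IH]; first by rewrite /geo big_ord0 mulr0 expr0 subrr.
by rewrite geoS mulrDr IH exprS; ring.
Qed.

(** In x = q^m the double sum factors: the sum over s is geometric, the one over t is (1 + x^(2r+1))
    / (1 + x). The reflections s -> 2 j - s and t -> 2 r - t preserve (-1)^t, so both terms of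
    [theta_coef] contribute equally. *)
Lemma target_theta (F : fieldType) (q : F) k j r m : qregular q -> (j + r <= k)%N ->
  target q k j r m = \sum_(s < (2 * j).+1) \sum_(t < (2 * r).+1) (-1) ^+ t *
    theta_coef (q ^+ (2 * k + 2)) (q ^+ (k.+1 - r - j + s + t))
      (q ^+ (k.+1 - r - j + (2 * j - s) + (2 * r - t))) m.
Proof.
move=> hq hk; set x := q ^+ m; set e := (k.+1 - r - j)%N.
pose P := q ^+ 'C(m, 2) ^+ (2 * k.+1).
have xa a : q ^+ a ^+ m = x ^+ a by rewrite exprAC.
have -> : \sum_(s < (2 * j).+1) \sum_(t < (2 * r).+1) (-1) ^+ t *
    theta_coef (q ^+ (2 * k + 2)) (q ^+ (e + s + t)) (q ^+ (e + (2 * j - s) + (2 * r - t))) m =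
  sgn_half F m * P * x ^+ e * (\sum_(s < (2 * j).+1) \sum_(t < (2 * r).+1) (-1) ^+ t * (x ^+ s * x ^+ t)
   + \sum_(s < (2 * j).+1) \sum_(t < (2 * r).+1) (-1) ^+ t * (x ^+ (2 * j - s) * x ^+ (2 * r - t))).
  rewrite -big_split mulr_sumr; apply: eq_bigr => s _; rewrite -big_split mulr_sumr.
  apply: eq_bigr => t _; rewrite /theta_coef !xa.
  have -> : q ^+ (2 * k + 2) ^+ 'C(m, 2) = P by rewrite exprAC; congr (_ ^+ _); lia.
  by rewrite !(exprD x) /=; ring.
have E1 : \sum_(s < (2 * j).+1) \sum_(t < (2 * r).+1) (-1) ^+ t * (x ^+ s * x ^+ t) =
    geo x (2 * j).+1 * geo (- x) (2 * r).+1.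
  rewrite /geo mulr_suml; apply: eq_bigr => s _; rewrite mulr_sumr; apply: eq_bigr => t _.
  by rewrite (exprNn x); ring.
have -> : \sum_(s < (2 * j).+1) \sum_(t < (2 * r).+1) (-1) ^+ t * (x ^+ (2 * j - s) * x ^+ (2 * r - t))
    = geo x (2 * j).+1 * geo (- x) (2 * r).+1.
  rewrite -E1 (reindex_inj rev_ord_inj); apply: eq_bigr => s _.
  rewrite (reindex_inj rev_ord_inj); apply: eq_bigr => t _ /=.
  have hs := ltn_ord s; have ht := ltn_ord t.
  rewrite !subSS; have -> : (2 * j - (2 * j - s) = s)%N by lia.
  have -> : (2 * r - (2 * r - t) = t)%N by lia.
  by rewrite -signr_odd oddB ?oddM //= signr_odd.
have h := qregular_neq0 m hq; rewrite -/x in h.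
have E2 : geo (- x) (2 * r).+1 = (1 + x ^+ (2 * r + 1)) / (1 + x).
  apply: (mulfI h); rewrite mulrCA divff // mulr1 -{1}[x]opprK geo_mul addn1.
  by rewrite exprNn -signr_odd /= oddM /= expr1; ring.
rewrite E1 E2 /target -/x -/P -/e (addn1 (2 * j)).
by field; rewrite h.
Qed.

Lemma nm_expr_le (R : realType) (q : R[i]) a n : nm q <= 1 -> (a <= n)%N -> nm (q ^+ n) <= nm q ^+ a.
Proof. by move=> q1 h; rewrite nmX; apply: ler_wiXn2l => //; apply: nm_ge0. Qed.

(** Bounded through [target_theta], where the denominator 1 + q^m is gone. *)
Lemma nm_target_le (R : realType) (q : R[i]) k j r m : nm q < 1 -> (j + r <= k)%N ->
  nm (target q k j r m) <= ((2 * j).+1 * (2 * r).+1)%:R * 2 * nm q ^+ m.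
Proof.
move=> q1 hk; have q1' := ltW q1; rewrite target_theta //; last exact: nm_qregular.
apply: le_trans (nm_sum _ _ _) _.
apply: (@le_trans _ _ (\sum_(s < (2 * j).+1) \sum_(t < (2 * r).+1) 2 * nm q ^+ m)); last first.
  by rewrite !sumr_const !card_ord -mulrnA -[leLHS]mulr_natl (mulnC (2 * r).+1) mulrA.
apply: ler_sum => s _; apply: le_trans (nm_sum _ _ _) _; apply: ler_sum => t _.
rewrite Normc.normcM nmX normcN Normc.normc1 expr1n mul1r.
apply: nm_theta_le; first by rewrite nmX exprn_ile1 ?nm_ge0.
  by rewrite -[leRHS]expr1; apply: nm_expr_le => //; lia.
by rewrite -[leRHS]expr1; apply: nm_expr_le => //; lia.
Qed.

Lemma nm_1D_le (R : realType) (z : R[i]) : nm z <= 1 -> nm (1 + z) <= 2.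
Proof.
move=> hz; apply: le_trans (le_normcD _ _) _; rewrite Normc.normc1 (_ : 2 = 1 + 1) //.
by rewrite lerD2l.
Qed.

Lemma nm_geo_le (R : realType) (y : R[i]) n : nm y <= 1 -> nm (geo y n) <= n%:R.
Proof.
move=> hy; apply: le_trans (nm_sum _ _ _) _.
apply: (@le_trans _ _ (\sum_(l < n) 1)); last by rewrite sumr_const card_ord.
by apply: ler_sum => l _; rewrite nmX exprn_ile1 ?nm_ge0.
Qed.

Lemma nm_mul_le (R : realType) (x y : R[i]) (a b : R) :
  nm x <= a -> nm y <= b -> nm (x * y) <= a * b.
Proof. by move=> ha hb; rewrite Normc.normcM; apply: ler_pM; rewrite ?nm_ge0. Qed.

Lemma nm_exp1 (R : realType) (x : R[i]) n : nm x <= 1 -> nm (x ^+ n) <= 1.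
Proof. by move=> hx; rewrite nmX exprn_ile1 ?nm_ge0. Qed.

Lemma nm_defect_le (R : realType) (q : R[i]) k j r m : nm q < 1 ->
  nm (defect q k j r m) <= 8 * j%:R * nm q ^+ m.
Proof.
move=> /ltW q1; have two : nm (2 : R[i]) <= 2 by rewrite nm2.
have x1 n : nm (q ^+ n) <= 1 := nm_exp1 n q1.
(* With x = q^m, the factor 8 collects the constant 2 and the bounds of 1 + x^(2r+1) and 1 + x; j
   bounds the geometric sum, and the decay comes from the factor x of [acoef]. *)
have -> : 8 * j%:R * nm q ^+ m =
  1 * (1 * 1 * nm q ^+ m * 2) * (1 * 1 * (2 * 1) * j%:R * 2) by ring.
rewrite /defect /acoef; apply: nm_mul_le.
  apply: nm_mul_le; first exact: nm_half.
  apply: nm_mul_le; last exact/nm_1D_le/nm_exp1.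
  by apply: nm_mul_le; [apply: nm_mul_le; [|apply: nm_exp1] | rewrite nmX].
apply: nm_mul_le; last exact: nm_1D_le.
apply: nm_mul_le; last exact/nm_geo_le/nm_exp1.
apply: nm_mul_le; last exact: nm_mul_le.
apply: nm_mul_le; apply: nm_exp1 => //.
by rewrite -[leRHS]mul1r; apply: nm_mul_le => //; apply: nm_exp1.
Qed.

Lemma nm_ratio_le (R : realType) (q : R[i]) n : nm q < 1 ->
  nm (q ^+ n / (1 + q ^+ n)) <= nm q ^+ n * (1 - nm q)^-1.
Proof.
move=> q1; have h1 : 0 < 1 - nm q by rewrite subr_gt0.
apply: nm_mul_le; rewrite ?nmX // Normc.normcV.
have low : 1 - nm q <= nm (1 + q ^+ n).
  case: n => [|n].
    by rewrite expr0 -[1 + 1]/(2 : R[i]) nm2; have := nm_ge0 q; lra.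
  have := le_normcD (1 + q ^+ n.+1) (- q ^+ n.+1); rewrite addrK normcN Normc.normc1 nmX.
  rewrite -lerBlDr => h; apply: le_trans h; rewrite lerD2l lerN2.
  by rewrite exprS ler_piMr ?nm_ge0 // exprn_ile1 ?nm_ge0 // ltW.
by rewrite lef_pV2 ?posrE // (lt_le_trans h1).
Qed.

Lemma cvg_target (R : realType) (q : R[i]) k j r : nm q < 1 -> (j + r <= k)%N ->
  ((fun n => \sum_(m < n.+1) target q k j r m) : nat -> R[i]^o) @ \oo -->
  (\sum_(s < (2 * j).+1) \sum_(t < (2 * r).+1) (-1) ^+ t *
    qpochs_inf [:: q ^+ (2 * k + 2); q ^+ (k.+1 - r - j + s + t);
      q ^+ (k.+1 - r - j + (2 * j - s) + (2 * r - t))] (q ^+ (2 * k + 2)) : R[i]^o).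
Proof.
move=> q1 hk; have q1' := ltW q1; have hq := nm_qregular q1.
have E n : \sum_(m < n.+1) target q k j r m =
  \sum_(s < (2 * j).+1) \sum_(t < (2 * r).+1) (-1) ^+ t * \sum_(m < n.+1)
    theta_coef (q ^+ (2 * k + 2)) (q ^+ (k.+1 - r - j + s + t))
      (q ^+ (k.+1 - r - j + (2 * j - s) + (2 * r - t))) m.
  under eq_bigr do rewrite target_theta //.
  rewrite exchange_big; apply: eq_bigr => s _; rewrite exchange_big; apply: eq_bigr => t _.
  by rewrite mulr_sumr.
rewrite (eq_fun E).
apply: (@cvgC_sum R nat _ \oo _ _ (fun s n => _) (fun s => _)) => s.
apply: (@cvgC_sum R nat _ \oo _ _ (fun t n => _) (fun t => _)) => t.
apply: cvgM; first exact: cvg_cst.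
have hs := ltn_ord s; have ht := ltn_ord t.
apply: (@jacobi_triple_product _ _ _ _ (nm q)) => //.
- by rewrite nmX exprn_ilt1 ?nm_ge0 // addnC.
- by rewrite -[leRHS]expr1; apply: nm_expr_le => //; lia.
- by rewrite -[leRHS]expr1; apply: nm_expr_le => //; lia.
- by rewrite -exprD; congr (_ ^+ _); lia.
- move=> /eqP; rewrite expf_eq0 => /andP[_ /eqP->].
  by rewrite !expr0n; split; rewrite (_ : (_ == 0%N) = false) //; lia.
Qed.

(** In the proof, [d1] is the error made by replacing the truncating factor 1 / (q)_(n-m) by its
    limit, [d2] the one made by replacing the kernel by its limit and dropping the defect. The bound
    on f provides the majorant of [d1]. *)
Lemma cvg_head_sum (R : realType) (q : R[i]) k j r (K s : R) :
  nm q < 1 -> (0 < k)%N -> (j + r <= k)%N -> 0 <= s < 1 ->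
  let f n := head_weight q k j r n * nest q (tail_weight q k j r) k.-1 2 n in
  (forall n, nm (f n) <= K * s ^+ n) ->
  ((fun n => \sum_(m < n.+1) f m) : nat -> R[i]^o) @ \oo -->
  (qpoch_inf (- q) q / qpoch_inf q q *
   (\sum_(s < (2 * j).+1) \sum_(t < (2 * r).+1) (-1) ^+ t *
    qpochs_inf [:: q ^+ (2 * k + 2); q ^+ (k.+1 - r - j + s + t);
      q ^+ (k.+1 - r - j + (2 * j - s) + (2 * r - t))] (q ^+ (2 * k + 2))) : R[i]^o).
Proof.
move=> q1 k0 hk hs f hf; have hq := nm_qregular q1.
have cn0 := qpoch_inf_neq0 q1; set c := qpoch_inf q q in cn0 *.
set T := \sum_(s0 < _) _; have cT := cvg_target q1 hk; rewrite -/T in cT.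
have [b b0 hb] := nm_qp_ge q1; have [D D0 hD] := nm_kern_le q1.
have hsq : 0 <= nm q < 1 by rewrite nm_ge0.
have h1 : 0 < 1 - nm q by rewrite subr_gt0.
pose d1 n m := f m * ((qp q q (n - m))^-1 - c^-1).
have d1_0 : ((fun n => \sum_(m < n.+1) d1 n m) : nat -> R[i]^o) @ \oo --> (0 : R[i]^o).
  apply: (@tannery0 _ _ (K * (b^-1 + nm c^-1)) s hs) => [n m _|m].
    rewrite mulrAC; apply: nm_mul_le => //; apply: le_trans (le_normcD _ _) _.
    by rewrite normcN lerD2r Normc.normcV lef_pV2 ?posrE // (lt_le_trans b0).
  rewrite -[X in _ --> X](mulr0 (f m)); apply: cvgM; first exact: cvg_cst.
  rewrite -[X in _ --> X](subrr c^-1); apply: cvgB; last exact: cvg_cst.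
  by apply: cvg_qp_inv => // M; exists (M + m)%N => n; lia.
pose g n := q ^+ n / (1 + q ^+ n).
pose d2 n m := (target q k j r m - defect q k j r m * g n) * kern q 0 n m
   - target q k j r m * c^-2.
have g0 : (g : nat -> R[i]^o) @ \oo --> (0 : R[i]^o).
  apply: cvg_nm0; apply: (@squeeze_cvgr _ _ _ _ (fun=> 0) (fun n => (1 - nm q)^-1 * nm q ^+ n)).
  - by near=> n; rewrite nm_ge0 sub0r normcN mulrC nm_ratio_le.
  - exact: cvg_cst.
  - by apply: cvg_geometric; rewrite ger0_norm ?nm_ge0.
have d2_0 : ((fun n => \sum_(m < n.+1) d2 n m) : nat -> R[i]^o) @ \oo --> (0 : R[i]^o).
  pose K1 : R := ((2 * j).+1 * (2 * r).+1)%:R * 2.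
  pose K2 : R := 8 * j%:R.
  have d2E n m : d2 n m = target q k j r m * (kern q 0 n m - c^-2)
      - defect q k j r m * (g n * kern q 0 n m) by rewrite /d2; ring.
  apply: (@tannery0 _ _ (K1 * (D + nm (c^-2)) + K2 * ((1 - nm q)^-1 * D)) (nm q) hsq) => [n m _|m].
    rewrite d2E mulrDl (mulrAC K1) (mulrAC K2); apply: le_trans (le_normcD _ _) _.
    rewrite normcN; apply: lerD; apply: nm_mul_le.
    - exact: nm_target_le.
    - by apply: le_trans (le_normcD _ _) _; rewrite normcN lerD2r.
    - exact: nm_defect_le.
    - apply: nm_mul_le => //; apply: le_trans (nm_ratio_le n q1) _.
      by rewrite ler_piMl ?invr_ge0 ?(ltW h1) // exprn_ile1 ?nm_ge0 // ltW.
  rewrite (eq_fun (d2E ^~ m)).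
  have ck := cvg_kern m q1; rewrite -/c in ck.
  have := cvgCB (cvgCM (@cvgC_cst R (target q k j r m)) (cvgCB ck (@cvgC_cst R (c^-2))))
    (cvgCM (@cvgC_cst R (defect q k j r m)) (cvgCM g0 ck)).
  by rewrite subrr mul0r !mulr0 subrr => H; exact: H.
have E n : \sum_(m < n.+1) f m =
    c * (qp (- q) q n * (c^-2 * \sum_(m < n.+1) target q k j r m + \sum_(m < n.+1) d2 n m)
         - \sum_(m < n.+1) d1 n m).
  have -> : c^-2 * \sum_(m < n.+1) target q k j r m + \sum_(m < n.+1) d2 n m =
     \sum_(m < n.+1) (target q k j r m - defect q k j r m * g n) * kern q 0 n m.
    rewrite mulr_sumr -big_split; apply: eq_bigr => m _ /=; rewrite /d2; ring.
  rewrite -(finite_identity n hq k0 hk) /bstep -sumrB mulr_sumr.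
  by apply: eq_bigr => m _; rewrite /d1 /f; field; rewrite cn0 qp_neq0.
rewrite (eq_fun E).
have -> : qpoch_inf (- q) q / c * T = c * (qpoch_inf (- q) q * (c^-2 * T + 0) - 0).
  by field; rewrite cn0.
exact: (cvgCM (@cvgC_cst R c)
  (cvgCB (cvgCM (@qp_cvg R (- q) q q1) (cvgCD (cvgCM (@cvgC_cst R (c^-2)) cT) d2_0)) d1_0)).
Unshelve. all: by end_near. Qed.

(** * Majorants of the multisum and the form of its terms *)

Lemma sum_nm_chain_term (R : realType) (q : R[i]) (W : nat -> nat -> R[i]) (s b a : R) d i n :
  0 <= s < 1 -> 0 < b -> 0 < a -> (forall n, b <= nm (qp q q n)) ->
  (forall i n, nm (W i n) <= a * s ^+ n) ->
  \sum_(l <- decseqs d n) nm (chain_term q W i n l) <= b^-1 * (a / b / (1 - s)) ^+ d.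
Proof.
move=> hs b0 a0 hb hW; have /andP[s0 s1] := hs; have h1 : 0 < 1 - s by rewrite subr_gt0.
have hbV m : nm (qp q q m)^-1 <= b^-1.
  by rewrite Normc.normcV lef_pV2 ?posrE // (lt_le_trans b0).
elim: d i n => [|d IH] i n; first by rewrite big_seq1 expr0 mulr1 /=; apply: hbV.
rewrite sum_decseqsS.
(* Each variable contributes a / b from its weight and denominator, and 1 / (1 - s) from its
   summation, uniformly in n. *)
apply: (@le_trans _ _ (\sum_(0 <= m < n.+1) (a / b * (b^-1 * (a / b / (1 - s)) ^+ d)) * s ^+ m)).
  rewrite big_mkord; apply: ler_sum => m _ /=.
  under eq_bigr => l _ do rewrite Normc.normcM.
  rewrite -mulr_sumr [leRHS]mulrAC; apply: ler_pM; rewrite ?nm_ge0 ?sumr_ge0 ?IH //.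
    by move=> l _; apply: nm_ge0.
  by rewrite mulrAC; apply: nm_mul_le.
rewrite -mulr_sumr exprS.
have -> : b^-1 * (a / b / (1 - s) * (a / b / (1 - s)) ^+ d) =
   (a / b * (b^-1 * (a / b / (1 - s)) ^+ d)) * (1 - s)^-1 by ring.
by rewrite ler_wpM2l ?geo_sum_le // !mulr_ge0 ?exprn_ge0 ?mulr_ge0 ?invr_ge0 // ltW.
Qed.

(** The exponents of the multisum dominate n only up to 1, as n^2 - n does at n = 1; this costs the
    factor s^-1. *)
Lemma nm_expr_shift_le (R : realType) (q : R[i]) (s : R) e n : nm q <= s -> 0 < s <= 1 ->
  (n <= e.+1)%N -> nm (q ^+ e) <= s^-1 * s ^+ n.
Proof.
move=> qs /andP[s0 s1] hne; rewrite nmX ler_pdivlMl //.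
apply: (@le_trans _ _ (s ^+ e.+1)); last by apply: ler_wiXn2l => //; apply: ltW.
by rewrite exprS ler_wpM2l ?(ltW s0) // lerXn2r ?nnegrE ?nm_ge0 ?(ltW s0).
Qed.

Lemma head_exp_ge k j r n : (n <= (head_exp k j r n).+1)%N.
Proof.
have : (n <= ('C(n, 2)).+1)%N by case: n => [|[|n]] //; rewrite binS bin1; lia.
by rewrite /head_exp binS bin1; case: (0 < j)%N; case: (k <= r)%N; lia.
Qed.

Lemma tail_exp_ge k j r i n : (n <= (tail_exp k j r i n).+1)%N.
Proof.
by rewrite /tail_exp; case: (i <= j)%N; case: (k - r < i)%N; nia.
Qed.

Lemma chain_termE (F : fieldType) (q : F) (W : nat -> nat -> F) i n l :
  chain_term q W i n l = \prod_(a < size l)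
    (W (i + a)%N (nth 0%N l a) / qp q q (nth 0%N (n :: l) a - nth 0%N l a))
    / qp q q (last n l).
Proof.
elim: l i n => [|s l IH] i n /=; first by rewrite big_ord0 mul1r.
rewrite IH mulrA; congr (_ / _); rewrite big_ord_recl /= addn0; congr (_ * _).
by apply: eq_bigr => a _; rewrite addSnnS.
Qed.

(** The sums over the first j and the last r variables are spread over all indices by indicator
    factors, so that each variable collects its own exponent, a natural number. *)
Lemma multisum_exponentE k j r (s : noninc k.+1) : (j + r <= k.+1)%N ->
  multisum_exponent j r s = (head_exp k.+1 j r (part s 1) +
    \sum_(2 <= i < k.+2) tail_exp k.+1 j r i (part s i))%N%:Z.
Proof.
move=> hk; rewrite /multisum_exponent; set x := part s.
have E1 : \sum_(1 <= i < j.+1) (x i)%:Z = \sum_(1 <= i < k.+2) ((i <= j) * x i)%N%:Z.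
  rewrite (big_nat_widen _ _ k.+2) /=; last by lia.
  by rewrite big_mkcond; apply: eq_bigr => i _; rewrite ltnS; case: (i <= j)%N; rewrite ?mul1n.
have E2 : \sum_((k.+1 - r).+1 <= i < k.+2) (x i)%:Z =
    \sum_(1 <= i < k.+2) ((k.+1 - r < i) * x i)%N%:Z.
  rewrite [RHS](@big_cat_nat _ _ _ (k.+1 - r).+1) //=; last by lia.
  rewrite [X in _ = X + _]big_nat [X in _ = X + _]big1 ?add0r; last first.
    by move=> i hi; rewrite (_ : (k.+1 - r < i)%N = false) //; lia.
  by rewrite big_nat [RHS]big_nat; apply: eq_bigr => i /andP[-> _]; rewrite mul1n.
rewrite E1 E2 !(big_ltn (isT : 1 < k.+2)%N) PoszD (big_morph Posz PoszD (erefl _)).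
have E3 : \sum_(2 <= i < k.+2) (tail_exp k.+1 j r i (x i))%:Z =
    \sum_(2 <= i < k.+2) (x i)%:Z ^+ 2 - \sum_(2 <= i < k.+2) ((i <= j) * x i)%N%:Z
    + \sum_(2 <= i < k.+2) ((k.+1 - r < i) * x i)%N%:Z.
  rewrite -sumrB -big_split; apply: eq_bigr => i _ /=; rewrite /tail_exp.
  have h : ((i <= j) * x i <= x i ^ 2)%N by case: (i <= j)%N; nia.
  by rewrite PoszD -subzn // PoszX.
have E4 : (head_exp k.+1 j r (x 1%N))%:Z = ((x 1%N ^ 2 + x 1%N)./2)%N%:Z
    - ((1 <= j) * x 1%N)%N%:Z + ((k.+1 - r < 1) * x 1%N)%N%:Z.
  have -> : ((x 1%N ^ 2 + x 1%N)./2 = 'C((x 1%N).+1, 2))%N.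
    by rewrite bin2 /=; congr (_./2); nia.
  have h : ((0 < j) * x 1%N <= 'C((x 1%N).+1, 2))%N by rewrite binS bin1; case: (0 < j)%N; lia.
  rewrite /head_exp PoszD -subzn //; congr (_ + (_ * _)%N%:Z).
  by rewrite ltnS leqn0 subn_eq0.
rewrite E3 E4; ring.
Qed.

Lemma multisum_termE (R : realType) (q : R[i]) k j r (s : noninc k.+1) : (j + r <= k.+1)%N ->
  multisum_term q j r s = (fun l => head_weight q k.+1 j r (head 0%N l) *
    chain_term q (tail_weight q k.+1 j r) 2 (head 0%N l) (behead l)) (val (val s)).
Proof.
move=> hk; rewrite /multisum_term multisum_exponentE // -exprnP.
have [n [l [hl el]]] : exists n l, size l = k /\ val (val s) = n :: l.
  case: s => [[[//|n l] hs] ?]; exists n, l; split => //.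
  by apply/eqP; rewrite -eqSS.
have pE i : part s i.+1 = nth 0%N (n :: l) i by rewrite /part el.
rewrite el /= chain_termE pE hl exprD /head_weight /=.
have -> : \prod_(1 <= i < k.+1) qpoch q q (part s i - part s i.+1) =
    \prod_(a < k) qp q q (nth 0%N (n :: l) a - nth 0%N l a).
  by rewrite big_add1 big_mkord; apply: eq_bigr => a _; rewrite !pE.
rewrite [in RHS]big_split prodfV /=.
have -> : q ^+ (\sum_(2 <= i < k.+2) tail_exp k.+1 j r i (part s i)) =
    \prod_(a < k) tail_weight q k.+1 j r (2 + a) (nth 0%N l a).
  rewrite (big_morph _ (exprD q) (expr0 q)) 2!big_add1 big_mkord.
  by apply: eq_bigr => a _; rewrite /tail_weight pE.
have -> : part s k.+1 = last n l by rewrite pE (last_nth 0%N) hl.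
rewrite -[qpoch q q _]/(qp q q _) -[qpoch (-1) q n]/(qp (-1) q n) invfM; ring.
Qed.

Theorem theorem4p3 (R : realType) (q : R[i]) (j r k : nat)
    (hq : `|q| < 1) (hk : (1 <= k)%N) (hjr : (j + r <= k)%N) :
  has_sum (fun s : noninc k => multisum_term q j r s)
    (qpoch_inf (- q) q / qpoch_inf q q *
     \sum_(0 <= s < (2 * j).+1) \sum_(0 <= t < (2 * r).+1)
       (-1) ^+ t *
       qpochs_inf
         [:: q ^+ (2 * k + 2);
             q ^ (k%:Z + 1 - r%:Z - j%:Z + s%:Z + t%:Z);
             q ^ (k%:Z + 1 + r%:Z + j%:Z - s%:Z - t%:Z)]
         (q ^+ (2 * k + 2))).
Proof.
have q1 := nm_lt1 hq; case: k hk hjr => // k _ hjr.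
(* Not the modulus of q itself, which may be 0, because the majorants involve s^-1. *)
pose s : R := Num.max (nm q) 2^-1.
have s0 : 0 < s by rewrite lt_max invr_gt0 ltr0n orbT.
have s1 : s < 1 by rewrite gt_max q1 invf_lt1 ?ltr1n.
have qs : nm q <= s by rewrite le_max lexx.
have hs : 0 <= s < 1 by rewrite ltW.
have hs' : 0 < s <= 1 by rewrite s0 ltW.
have [b b0 hb] := nm_qp_ge q1; have [B B0 hB] := @nm_qp_le R (-1) q q1.
pose g l := head_weight q k.+1 j r (head 0%N l) *
  chain_term q (tail_weight q k.+1 j r) 2 (head 0%N l) (behead l).
pose f n := head_weight q k.+1 j r n * nest q (tail_weight q k.+1 j r) k 2 n.
(* The factors s^-1 and B bound the weight of s_1; the rest bounds the inner sums, with a = s^-1. *)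
pose K : R := s^-1 * B * (b^-1 * (s^-1 / b / (1 - s)) ^+ k).
have gf n : \sum_(t <- decseqs k n) g (n :: t) = f n.
  by rewrite /g /f -sum_chain_term mulr_sumr.
have gK n : \sum_(t <- decseqs k n) nm (g (n :: t)) <= K * s ^+ n.
  rewrite /g /=; under eq_bigr => t _ do rewrite Normc.normcM.
  rewrite -mulr_sumr /K mulrAC; apply: ler_pM; rewrite ?nm_ge0 ?sumr_ge0 //.
  - by move=> t _; apply: nm_ge0.
  - rewrite mulrAC; apply: nm_mul_le; last exact: hB.
    by apply: nm_expr_shift_le => //; apply: head_exp_ge.
  - apply: sum_nm_chain_term => //; first by rewrite invr_gt0.
    by move=> i m; apply: nm_expr_shift_le => //; apply: tail_exp_ge.
have fK n : nm (f n) <= K * s ^+ n.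
  by rewrite -gf; apply: le_trans (nm_sum _ _ _) (gK n).
have lim := @cvg_head_sum R q k.+1 j r K s q1 isT hjr hs fK.
have := has_sum_noninc hs gf gK lim.
rewrite (_ : (fun t : noninc k.+1 => g (val (val t))) = (fun t => multisum_term q j r t)); last first.
  by apply/funext => t; rewrite multisum_termE.
congr (has_sum _ (_ * _)).
rewrite big_mkord; apply: eq_bigr => a _; rewrite big_mkord; apply: eq_bigr => t _.
have ha := ltn_ord a; have ht := ltn_ord t.
(* By the bounds on j + r, s and t these integer exponents are positive, hence equal to the natural
   ones of the limit. *)
congr (_ * qpochs_inf [:: _; _; _] _).
- rewrite exprnP; congr (_ ^ _); lia.
- rewrite exprnP; congr (_ ^ _); lia.
Qed.
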